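(* Let $\mu\preceq\nu$ be probability measures on $\mathbb{R}$ with finite first moments, and assume that $\mu$ has no atoms. Then there exists precisely one left-monotone martingale coupling for $\mu,\nu$, i.e. precisely one left-monotone $\mathbb{P}\in\mathcal{M}(\mu,\nu)$.
   Context: $(X,Y)$ denotes the canonical process on $\mathbb{R}\times\mathbb{R}$: $X(x,y)=x$, $Y(x,y)=y$. $\mu\preceq\nu$ (convex order) means $\int g\,d\mu\le\int g\,d\nu$ for every convex function $g$. $\mathcal{M}(\mu,\nu)$ is the set of probability measures $\mathbb{P}$ on $\mathbb{R}\times\mathbb{R}$ with $X\sim_{\mathbb{P}}\mu$, $Y\sim_{\mathbb{P}}\nu$ and $\mathbb{E}^{\mathbb{P}}[Y|X]=X$ $\mu$-a.s. $\mathbb{P}\in\mathcal{M}(\mu,\nu)$ is left-monotone if there exists a Borel set $\Gamma\subset\mathbb{R}\times\mathbb{R}$ with $\mathbb{P}[(X,Y)\in\Gamma]=1$ such that for all $(x,y_0),(x,y_1),(x',y')\in\Gamma$ with $x<x'$, one has $y'\notin(y_0,y_1)$. *)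

(* Defs.v *)
From HB Require Import structures.
From mathcomp Require Import all_boot all_order all_algebra.
From mathcomp Require Import all_classical all_reals all_analysis.
From mathcomp.analysis Require Import giry.

Set Implicit Arguments.
Unset Strict Implicit.
Unset Printing Implicit Defensive.

Import Order.TTheory GRing.Theory Num.Theory.
Import numFieldNormedType.Exports.

Local Open Scope classical_set_scope.
Local Open Scope ring_scope.

(* Measures are compared with the library's [measure_eq], i.e. on measurable
   sets: a [probability] is a total function on [set T], unconstrained on
   nonmeasurable sets, so Leibniz equality would be too fine. *)

Definition finite_first_moment (R : realType) (mu : probability R R) : Prop :=
  mu.-integrable [set: R] (fun x => x%:E).

Definition atomless (R : realType) (mu : probability R R) : Prop :=
  forall x : R, mu [set x] = 0%E.

(* A convex function is bounded below by an affine one, so under finite first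
   moments both integrals are well defined, with values in ]-oo, +oo]. *)
Definition convex_order (R : realType) (mu nu : probability R R) : Prop :=
  forall g : R -> R, @convex_function R R^o setT g ->
    (\int[mu]_x (g x)%:E <= \int[nu]_x (g x)%:E)%E.

(* [g] is a version of x |-> E^P[Y | X = x], i.e. g(X) = E^P[Y | sigma(X)];
   the elements of sigma(X) are the preimages by X of Borel sets. *)
Definition is_cond_expectation d (T : measurableType d) (R : realType)
    (P : probability T R) (X Y : {RV P >-> R}) (g : R -> R) : Prop :=
  [/\ P.-integrable [set: T] (fun w => (Y w)%:E),
      measurable_fun [set: R] g,
      P.-integrable [set: T] (fun w => (g (X w))%:E) &
      forall B : set R, measurable B ->
        (\int[P]_(w in X @^-1` B) (Y w)%:E =
         \int[P]_(w in X @^-1` B) (g (X w))%:E)%E].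

Section canonical_process.
Context (R : realType) (P : probability (R * R)%type R).

Let measurable_coord1 : measurable_fun [set: R * R] (fun z : R * R => z.1).
Proof. exact: measurable_fst. Qed.

Let measurable_coord2 : measurable_fun [set: R * R] (fun z : R * R => z.2).
Proof. exact: measurable_snd. Qed.

Definition canonX : {RV P >-> R} := mfun_Sub (mem_set measurable_coord1).

Definition canonY : {RV P >-> R} := mfun_Sub (mem_set measurable_coord2).

Lemma canonXE : canonX = fst :> (R * R -> R). Proof. by []. Qed.

Lemma canonYE : canonY = snd :> (R * R -> R). Proof. by []. Qed.

End canonical_process.
Arguments canonX {R} P.
Arguments canonY {R} P.

Definition martingale_coupling (R : realType) (mu nu : probability R R)
    (P : probability (R * R)%type R) : Prop :=
  [/\ measure_eq (distribution P (canonX P)) mu,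
      measure_eq (distribution P (canonY P)) nu &
      exists2 g : R -> R, is_cond_expectation (canonX P) (canonY P) g &
                          {ae mu, forall x, g x = x}].

Definition left_monotone (R : realType)
    (P : probability (R * R)%type R) : Prop :=
  exists Gamma : set (R * R),
    [/\ measurable Gamma, P [set w | Gamma (canonX P w, canonY P w)] = 1%E &
        forall x y0 y1 x' y' : R,
          Gamma (x, y0) -> Gamma (x, y1) -> Gamma (x', y') -> x < x' ->
          y' \notin `]y0, y1[].

(* Main.v *)
Require Import Defs.
From HB Require Import structures.
From mathcomp Require Import all_boot all_order all_algebra.
From mathcomp Require Import all_classical all_reals all_analysis.
From mathcomp Require Import measurable_realfun.
From mathcomp.analysis Require Import giry.
From mathcomp Require Import ring lra.

Set Implicit Arguments.
Unset Strict Implicit.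
Unset Printing Implicit Defensive.

Import Order.TTheory GRing.Theory Num.Theory.
Import numFieldNormedType.Exports.
Local Open Scope classical_set_scope.
Local Open Scope ring_scope.

(** The left-monotone coupling is the one whose partial second marginals are
    shadows. Write P_m for the potential k |-> int max(k - y, 0) m(dy) of a
    measure m, mu_x for the restriction of mu to ]-oo, x], and F_x for the
    greatest convex minorant of P_nu - P_(mu_x). The claim behind the theorem is
    that a martingale coupling P is left-monotone if and only if, for every x,
    the mass that starts in ]-oo, x] is carried to the part of nu with potential
    P_nu - F_x; this part is the shadow of mu_x in nu.

    Shadows are measures, and they increase. If f and g are convex and u is the
    greatest convex minorant of f - g, then f - u is convex [sub_cvx_hull_cvx]:
    away from the contact set u is affine, and on it f - u touches its convex
    minorant g. With the two-step rule for hulls [cvx_hull_sub_hull] this shows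
    that F_x - F_y is convex for x <= y, and that so is P_nu - F_x. Convex
    functions with the right growth are potentials [pot_surjective], and
    potentials determine measures [pot_inj]; so the shadows form an increasing
    family of measures dominated by nu.

    Existence. The densities of the shadows with respect to nu are, as functions
    of x, conditional distribution functions of X given Y, and they yield a
    coupling with the prescribed partial marginals
    [coupling_of_increasing_family]. The asymptotes of the potentials give the
    martingale property. The coupling is left-monotone
    [shadow_coupling_left_monotone]: where F_x lies strictly below
    P_nu - P_(mu_x) it is affine, so no mass starting after x arrives there; at
    the other levels there is equality in Jensen's inequality, so no mass
    starting before x crosses them.

    Uniqueness. Let Q be left-monotone, and let U be the potential of Y on
    {X > x}. Jensen's inequality gives U <= F_x. A level that lies strictly
    inside no fibre of Gamma over ]-oo, x] is crossed by no mass starting there,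
    and U = P_nu - P_(mu_x) >= F_x at that level; the other levels lie in
    intervals that the mass starting after x avoids, and U is affine on them. So
    F_x - U is convex near each point where it is positive, it vanishes at
    infinity, and the maximum principle [max_principle] gives F_x <= U. Thus the
    law of Y on {X <= x} does not depend on Q. *)

(** * Convex functions and their greatest convex minorants *)

Section convexity.
Context {R : realType}.
Implicit Types f g h u D : R -> R.

(** Three-point form of convexity: free of divisions and of a convex parameter,
    it is linear in the values of f and thus suits linear arithmetic. *)
Definition cvx f := forall a k b, a <= k -> k <= b ->
  (b - a) * f k <= (b - k) * f a + (k - a) * f b.

Definition lip (L : R) f := forall s t, s <= t -> `|f t - f s| <= L * (t - s).

Lemma cvxD f g : cvx f -> cvx g -> cvx (fun k => f k + g k).
Proof. by move=> cf cg a k b ak kb; have := cf _ _ _ ak kb; have := cg _ _ _ ak kb; lra. Qed.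

Lemma cvx_affine (c d : R) : cvx (fun k => c + d * k).
Proof. by move=> a k b ak kb; lra. Qed.

Lemma cvx_max f g : cvx f -> cvx g -> cvx (fun k => Num.max (f k) (g k)).
Proof.
move=> cf cg a k b ak kb; have := cf _ _ _ ak kb; have := cg _ _ _ ak kb.
have fa : f a <= Num.max (f a) (g a) by rewrite le_max lexx.
have ga : g a <= Num.max (f a) (g a) by rewrite le_max lexx orbT.
have fb : f b <= Num.max (f b) (g b) by rewrite le_max lexx.
have gb : g b <= Num.max (f b) (g b) by rewrite le_max lexx orbT.
have bk0 : 0 <= b - k by lra.
have ka0 : 0 <= k - a by lra.
have := ler_wpM2l bk0 fa; have := ler_wpM2l bk0 ga.
have := ler_wpM2l ka0 fb; have := ler_wpM2l ka0 gb.
by have [_|_] := leP (f k) (g k); lra.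
Qed.

Lemma cvx_midpoint f k d : cvx f -> 0 <= d -> 2 * f k <= f (k - d) + f (k + d).
Proof.
rewrite le_eqVlt => cf /predU1P[<-|d0]; first by rewrite subr0 addr0; lra.
have := cf (k - d) k (k + d) ltac:(lra) ltac:(lra) => ?.
by rewrite -(ler_pM2l d0); lra.
Qed.

Lemma lipB L M f g : lip L f -> lip M g -> lip (L + M) (fun k => f k - g k).
Proof.
move=> lf lg s t st; have := lf _ _ st; have := lg _ _ st.
rewrite !ler_norml => /andP[? ?] /andP[? ?]; apply/andP; split; lra.
Qed.

Lemma lip_continuous L f : lip L f -> continuous f.
Proof.
move=> lf x; apply/cvgrPdist_le => e e0.
have L0 : 0 <= L by have := lf 0 1 ler01; have := normr_ge0 (f 1 - f 0); lra.
near=> t; have : `|x - t| <= e / (L + 1).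
  by near: t; apply: cvgr_dist_le => //; apply: divr_gt0 => //; lra.
rewrite ler_pdivlMr; last lra.
have [xt|tx] := leP x t.
  have := lf _ _ xt; rewrite (distrC x) (distrC (f x)) (@ger0_norm _ (t - x)); last lra.
  by move=> ? ?; nra.
have := lf _ _ (ltW tx); rewrite (@ger0_norm _ (x - t)); last lra.
by move=> ? ?; nra.
Unshelve. all: by end_near. Qed.

(** A continuous function that is midpoint-subconvex at some scale wherever it
    is positive cannot exceed its boundary values: at the largest point where
    the maximum is attained, the right neighbour would lie strictly below the
    maximum and the left one not above it. The scale d may depend on the
    point, so the condition is much weaker than local convexity. *)
Lemma max_principle D (a b : R) : continuous D -> a <= b -> D a <= 0 -> D b <= 0 ->
  (forall k, a < k < b -> 0 < D k -> exists d,
     [/\ 0 < d, a <= k - d, k + d <= b & 2 * D k <= D (k - d) + D (k + d)]) ->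
  forall k, a <= k <= b -> D k <= 0.
Proof.
move=> cD ab Da Db sub k akb.
have cD' : {within `[a, b], continuous D} by exact: continuous_subspaceT.
have [m mab mmax] := EVT_max ab cD'.
have [Dm|Dm] := leP (D m) 0.
  by apply: (le_trans (mmax k _)) => //; rewrite in_itv.
exfalso.
(* c is the last point where the maximum is reached *)
pose M := [set z | a <= z <= b /\ D z = D m].
have Mm : M m by split => //; move: mab; rewrite in_itv.
have supM : has_sup M by split; [exists m | exists b => z [/andP[]]].
pose c := sup M.
have cb : c <= b by apply: ge_sup; [exists m|move=> z [/andP[]]].
have mc : m <= c by apply: ub_le_sup => //; case: supM.
have ac : a <= c by move: mab; rewrite in_itv => /= /andP[? _]; lra.
have Dc : D c = D m.
  apply/eqP; rewrite eq_le mmax ?in_itv/= ?ac//= leNgt; apply/negP => lt.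
  have : \forall t \near c, D t < D m by exact: (cvgr_lt (D c) (cD c)).
  case/nbhs_ballP => e /= e0 he.
  have [z [zab Dz] cz] := sup_adherent e0 supM.
  have : D z < D m.
    apply: he; rewrite /ball/= ltr_norml; apply/andP; split.
      have : z <= c by apply: ub_le_sup; [case: supM|].
      by rewrite /c in cz *; lra.
    by rewrite /c in cz *; lra.
  by rewrite Dz ltxx.
have acb : a < c < b.
  apply/andP; split; rewrite lt_neqAle ?ac ?cb andbT; apply/eqP => e.
    by rewrite -e in Dc; lra.
  by rewrite e in Dc; lra.
have [|d [d0 ad db]] := sub c acb; first lra.
have D1 : D (c - d) <= D m by apply: mmax; rewrite in_itv/=; apply/andP; split; lra.
have D2 : D (c + d) < D m.
  rewrite lt_neqAle mmax ?in_itv/= ?db ?andbT; last lra.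
  apply/eqP => e; have : c + d <= c; last lra.
  by apply: ub_le_sup; [case: supM|split => //; apply/andP; split; lra].
by rewrite Dc; lra.
Qed.

Definition minorants h := [set g | cvx g /\ forall k, g k <= h k].

Definition cvx_hull h k := sup [set g k | g in minorants h].

Lemma le_cvx_hull h g k : cvx g -> (forall k, g k <= h k) -> g k <= cvx_hull h k.
Proof.
move=> cg gh; apply: ub_le_sup; last by exists g.
by exists (h k) => _ [g' [_ g'h] <-].
Qed.

Lemma cvx_hull_le h : minorants h !=set0 -> forall k, cvx_hull h k <= h k.
Proof.
by move=> [g mg] k; apply: ge_sup; [exists (g k), g|move=> _ [g' [_ g'h] <-]].
Qed.

Lemma cvx_hull_cvx h : minorants h !=set0 -> cvx (cvx_hull h).
Proof.
move=> [g0 mg0] a k b ak kb.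
have [ba|ba] := leP b a.
  have -> : k = a by lra.
  by have -> : b = a; lra.
rewrite -ler_pdivlMl ?subr_gt0//; apply: ge_sup; first by exists (g0 k), g0.
move=> _ [g [cg gh] <-]; rewrite ler_pdivlMl ?subr_gt0//.
apply: le_trans (cg _ _ _ ak kb) _.
by apply: lerD; apply: ler_wpM2l; rewrite ?subr_ge0//; exact: le_cvx_hull.
Qed.

Lemma cvx_hull_id h : cvx h -> cvx_hull h = h.
Proof.
move=> ch; apply/funext => k; apply/eqP; rewrite eq_le le_cvx_hull// andbT.
by apply: cvx_hull_le; exists h; split.
Qed.

(** The bound passes from h to its hull because the translate of the hull by d,
    lowered by L |d|, is again a convex minorant of h. *)
Lemma cvx_hull_lip L h : minorants h !=set0 -> lip L h -> lip L (cvx_hull h).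
Proof.
move=> mh lh s t st.
have L0 : 0 <= L * (t - s) by exact: le_trans (normr_ge0 _) (lh _ _ st).
have hl d : `|d| = t - s -> forall k, cvx_hull h (k + d) - L * (t - s) <= cvx_hull h k.
  move=> dE k; apply: (@le_cvx_hull h (fun k => cvx_hull h (k + d) - L * (t - s))) => {k}.
    move=> a k b ak kb.
    by have := cvx_hull_cvx mh (a:=a+d) (k:=k+d) (b:=b+d); rewrite !lerD2r => /(_ ak kb); lra.
  move=> k; have := cvx_hull_le mh (k + d).
  suff : `|h (k + d) - h k| <= L * (t - s) by rewrite ler_norml => /andP[]; lra.
  have [d0|d0] := leP 0 d.
    have := lh k (k + d); rewrite lerDl => /(_ d0) /le_trans; apply.
    by rewrite -dE ger0_norm//; lra.
  have := lh (k + d) k; rewrite gerDl (ltW d0) distrC => /(_ erefl) /le_trans; apply.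
  by rewrite -dE ltr0_norm//; lra.
rewrite ler_norml; apply/andP; split.
  have := hl (s - t) _ t; rewrite distrC ger0_norm ?subr_ge0// => /(_ erefl).
  by rewrite addrCA subrr addr0; lra.
have := hl (t - s) _ s; rewrite ger0_norm ?subr_ge0// => /(_ erefl).
by rewrite addrCA subrr addr0; lra.
Qed.

(** Where the hull stays strictly below h it has no curvature: the maximum of
    the hull and of a short chord of it is still a convex minorant of h, and so
    cannot exceed the hull. *)
Lemma cvx_hull_affine L h k : minorants h !=set0 -> lip L h -> cvx_hull h k < h k ->
  exists2 d, 0 < d & forall s z t, k - d <= s -> s <= z -> z <= t -> t <= k + d ->
    (t - s) * cvx_hull h z = (t - z) * cvx_hull h s + (z - s) * cvx_hull h t.
Proof.
move=> mh lh uh; set u := cvx_hull h in uh *.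
have L0 : 0 <= L by have := lh 0 1 ler01; have := normr_ge0 (h 1 - h 0); lra.
have lu : lip L u by exact: cvx_hull_lip.
(* within this radius h and the chords of u move by less than half of the gap *)
exists ((h k - u k) / (2 * (L + 1))); first by apply: divr_gt0; lra.
set d := _ / _.
have dE : d * (2 * (L + 1)) = h k - u k by rewrite /d mulfVK//; apply/eqP; lra.
have d0 : 0 < d by apply: divr_gt0; lra.
move=> s z t ks; rewrite le_eqVlt => /predU1P[->|sz] zt tk; first by lra.
have st : s < t by lra.
have near f : lip L f -> forall y, k - d <= y -> y <= k + d -> `|f y - f k| <= L * d.
  move=> lf y ky yk; have [yk'|ky'] := leP y k.
    by have := lf _ _ yk'; rewrite distrC => /le_trans; apply; apply: ler_wpM2l; lra.
  by have := lf _ _ (ltW ky') => /le_trans; apply; apply: ler_wpM2l; lra.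
pose sl := (u t - u s) / (t - s).
have slE : sl * (t - s) = u t - u s by rewrite /sl mulfVK//; apply/eqP; lra.
pose l y := (u s - sl * s) + sl * y.
have ls : l s = u s by rewrite /l; ring.
have lt : l t = u t by rewrite /l; lra.
have cu : cvx u by exact: cvx_hull_cvx.
have lchord y : (t - s) * l y = (t - y) * u s + (y - s) * u t.
  by rewrite /l; have -> : u t = u s + sl * (t - s); [lra|ring].
have st0 : 0 < t - s by lra.
suff lu' : forall y, l y <= u y.
  have := lu' z; have := cu s z t (ltW sz) zt; rewrite -lchord ler_pM2l// => ? ?.
  by congr (_ * _); lra.
move=> y; apply: (@le_trans _ _ (Num.max (u y) (l y))); first by rewrite le_max lexx orbT.
apply: (@le_cvx_hull h (fun y => Num.max (u y) (l y))) => {y}.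
  by apply: cvx_max => //; exact: cvx_affine.
move=> y; rewrite ge_max cvx_hull_le//=.
have [ys|sy] := leP y s.
  apply: le_trans (cvx_hull_le mh y); rewrite -/u.
  have ts : s - y + (t - s) = t - y by ring.
  have := cu y s t ys (ltW st).
  by have := lchord y; nra.
have [ty|yt] := leP t y.
  apply: le_trans (cvx_hull_le mh y); rewrite -/u.
  have := cu s t y (ltW st) ty.
  by have := lchord y; nra.
have := near h lh y ltac:(lra) ltac:(lra).
have := near u lu s ltac:(lra) ltac:(lra).
have := near u lu t ltac:(lra) ltac:(lra).
rewrite !ler_norml => /andP[_ ut] /andP[_ us] /andP[hy _].
suff : l y <= u k + L * d by nra.
by rewrite -(ler_pM2l st0) lchord; nra.
Qed.

(** Subtract from f - u, where u is the hull of f - g, a chord, and apply the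
    maximum principle. Where u < f - g, the hull u is affine and f - u is as
    convex as f; where u = f - g, the function f - u touches its convex
    minorant g. In terms of potentials: if f is the potential of a measure m,
    then f - u is again a potential, and it is that of a part of m. *)
Lemma sub_cvx_hull_cvx L f g : cvx f -> cvx g -> lip L f -> lip L g ->
  minorants (fun k => f k - g k) !=set0 ->
  cvx (fun k => f k - cvx_hull (fun k => f k - g k) k).
Proof.
move=> cf cg lf lg; set h := (fun k => f k - g k) => mh.
have lh : lip (L + L) h by exact: lipB.
have lu := cvx_hull_lip mh lh; set u := cvx_hull h in lu *.
have cu : cvx u by exact: cvx_hull_cvx.
move=> a k b ak kb.
have [ba|ba] := leP b a.
  have -> : k = a by lra.
  by have -> : b = a; lra.
pose sl := ((f b - u b) - (f a - u a)) / (b - a).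
have slE : sl * (b - a) = (f b - u b) - (f a - u a) by rewrite /sl mulfVK//; apply/eqP; lra.
pose D y := f y - u y - ((f a - u a - sl * a) + sl * y).
suff : D k <= 0.
  have b0 : 0 < b - a by lra.
  by rewrite -(ler_pM2l b0) /D; nra.
apply: (@max_principle D a b); last 1 first.
- by rewrite ak kb.
- apply: (@lip_continuous (L + (L + L) + `|sl|)) => s t st.
  have := lf _ _ st; have := lu _ _ st.
  have : `|sl * (t - s)| = `|sl| * (t - s) by rewrite normrM (@ger0_norm _ (t - s)) ?subr_ge0.
  have := ler_norm (sl * (t - s)); have := ler_norm (- (sl * (t - s))); rewrite normrN.
  by rewrite /D !ler_norml => ? ? ? /andP[? ?] /andP[? ?]; apply/andP; split; lra.
- exact: ltW.
- by rewrite /D; lra.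
- by rewrite /D; lra.
move=> y /andP[ay yb] _.
have [uh|] := ltP (u y) (h y).
  have [d d0 ua] := cvx_hull_affine mh lh uh.
  pose e := Num.min d (Num.min (y - a) (b - y)).
  have e0 : 0 < e by rewrite /e !lt_min d0 !subr_gt0 ay yb.
  have ed : e <= d by rewrite /e ge_min lexx.
  have ea : e <= y - a by rewrite /e !ge_min lexx orbT.
  have eb : e <= b - y by rewrite /e !ge_min lexx !orbT.
  exists e; split => //; [lra|lra|].
  have := ua (y - e) y (y + e) ltac:(lra) ltac:(lra) ltac:(lra) ltac:(lra).
  have := cvx_midpoint y cf (ltW e0).
  rewrite -/u => fm um; have {um} : 2 * u y = u (y - e) + u (y + e).
    by apply: (mulfI (lt0r_neq0 e0)); lra.
  by rewrite /D; lra.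
move=> hu.
have e : u y = h y by apply/eqP; rewrite eq_le hu cvx_hull_le.
pose d := Num.min (y - a) (b - y).
have d0 : 0 < d by rewrite /d !lt_min !subr_gt0 ay yb.
have da : d <= y - a by rewrite /d !ge_min lexx.
have db : d <= b - y by rewrite /d !ge_min lexx !orbT.
exists d; split => //; [lra|lra|].
have := cvx_midpoint y cg (ltW d0).
have := cvx_hull_le mh (y - d); have := cvx_hull_le mh (y + d).
by rewrite /D -/u e /h; lra.
Qed.

(** Any convex minorant of h - g, once g is added, is a convex minorant of h.
    This makes shadows associative: the shadow of a sum is obtained by taking
    the shadow of one summand after the other. *)
Lemma cvx_hull_sub_hull h g : cvx g -> minorants (fun k => h k - g k) !=set0 ->
  cvx_hull (fun k => cvx_hull h k - g k) = cvx_hull (fun k => h k - g k).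
Proof.
move=> cg [w [cw wh]].
have mh : minorants h !=set0.
  exists (fun k => w k + g k); split; first exact: cvxD.
  by move=> k; have := wh k; lra.
have mhg : minorants (fun k => cvx_hull h k - g k) !=set0.
  exists w; split => // k; suff : w k + g k <= cvx_hull h k by lra.
  by apply: (@le_cvx_hull h (fun k => w k + g k)); [exact: cvxD|move=> z; have := wh z; lra].
have mh' : minorants (fun k => h k - g k) !=set0 by exists w.
apply/funext => k; apply/eqP; rewrite eq_le; apply/andP; split.
  apply: le_cvx_hull; first exact: cvx_hull_cvx.
  by move=> z; have := cvx_hull_le mhg z; have := cvx_hull_le mh z; lra.
apply: le_cvx_hull; first exact: cvx_hull_cvx.
move=> z; suff : cvx_hull (fun k => h k - g k) z + g z <= cvx_hull h z by lra.
apply: (@le_cvx_hull h (fun z => cvx_hull (fun k => h k - g k) z + g z)).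
  by apply: cvxD => //; exact: cvx_hull_cvx.
by move=> y; have := cvx_hull_le mh' y; lra.
Qed.

End convexity.

(** * Potentials *)

Section hinge.
Context {R : realType}.
Implicit Types k y s t : R.

(** Up to affine functions, the functions hinge k generate the cone of convex
    functions of y; as functions of k they are the potentials of Dirac masses. *)
Definition hinge k y := Num.max (k - y) 0.

Lemma hinge_ge0 k y : 0 <= hinge k y.
Proof. by rewrite /hinge le_max lexx orbT. Qed.

Lemma hinge_cvx y : cvx (hinge^~ y).
Proof.
have -> : hinge^~ y = (fun k => Num.max (- y + 1 * k) (0 + 0 * k)).
  by apply/funext => k; rewrite /hinge; congr Num.max; ring.
by apply: cvx_max; exact: cvx_affine.
Qed.

Lemma hinge_slope_lo s t y : s <= t -> (t - s) * \1_`]-oo, s] y <= hinge t y - hinge s y.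
Proof.
move=> st; rewrite indicE mem_setE in_itv/= /hinge.
have [ys|ys] := leP y s; have [|] := leP (t - y) 0; have [|] := leP (s - y) 0 => /=; lra.
Qed.

Lemma hinge_slope_hi s t y : s <= t -> hinge t y - hinge s y <= (t - s) * \1_`]-oo, t[ y.
Proof.
move=> st; rewrite indicE mem_setE in_itv/= /hinge.
have [ys|ys] := ltP y t; have [|] := leP (t - y) 0; have [|] := leP (s - y) 0 => /=; lra.
Qed.

Lemma measurable_hinge k : measurable_fun setT (hinge k).
Proof. by apply: measurable_maxr => //; exact: measurable_funB. Qed.

End hinge.

Section potential.
Context d (T : measurableType d) (R : realType).
Implicit Types (m : {finite_measure set T -> \bar R}) (A B : set T) (Z : T -> R).

(** The put potential of the image under Z of the restriction of m to A. The
    set A and the map Z are parameters so that the potentials of the laws of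
    the two coordinates of a coupling, restricted to an event, need no
    auxiliary measure. *)
Definition pot (m : {measure set T -> \bar R}) A Z k := \int[m]_(w in A) hinge k (Z w).

(** Weaker than the integrability of Z: it only concerns the lower tail, which is
    all that is known of a measure built from its potential. *)
Definition hinge_integrable (m : {measure set T -> \bar R}) Z :=
  forall k, m.-integrable setT (fun w => (hinge k (Z w))%:E).

Lemma integrable_hinge m Z : m.-integrable setT (EFin \o Z) -> hinge_integrable m Z.
Proof.
move=> iZ k; have mZ := measurable_int _ iZ.
have i1 : m.-integrable setT (fun w => (k - Z w)%:E).
  exact: (integrableB measurableT (finite_measure_integrable_cst m k measurableT) iZ).
apply: le_integrable i1 => //.
  apply/measurable_EFinP; apply: measurableT_comp; first exact: measurable_hinge.
  exact/measurable_EFinP.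
move=> w _ /=; rewrite lee_fin ger0_norm ?hinge_ge0// /hinge ge_max normr_ge0 andbT.
exact: ler_norm.
Qed.

Lemma integrable_indicS m A B : measurable A -> measurable B ->
  m.-integrable A (EFin \o \1_B).
Proof. by move=> mA mB; apply: (@integrableS _ _ _ _ setT) => //; exact: integrable_indic. Qed.

Lemma Rintegral_indic m A B c : measurable A -> measurable B ->
  \int[m]_(w in A) (c * \1_B w) = c * fine (m (A `&` B)).
Proof.
move=> mA mB; rewrite RintegralZl//; last exact: integrable_indicS.
by rewrite /Rintegral integral_indic// setIC.
Qed.

Section theory.
Variables (m : {finite_measure set T -> \bar R}) (Z : T -> R).
Hypotheses (mZ : measurable_fun setT Z) (iZ : hinge_integrable m Z).

Let ih A k : measurable A -> m.-integrable A (EFin \o (fun w => hinge k (Z w))).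
Proof. by move=> mA; exact: integrableS (iZ k). Qed.

Let mZB (B : set R) : measurable B -> measurable (Z @^-1` B).
Proof. by move=> mB; rewrite -[X in measurable X]setTI; exact: mZ. Qed.

Lemma pot_ge0 A k : 0 <= pot m A Z k.
Proof. by apply: Rintegral_ge0 => w _; exact: hinge_ge0. Qed.

Lemma pot_cvx A : measurable A -> cvx (pot m A Z).
Proof.
move=> mA a k b ak kb; rewrite /pot -!RintegralZl//; [|exact: ih..].
rewrite -RintegralD//; last 2 first.
- exact: (integrableZl mA (b - k) (ih a mA)).
- exact: (integrableZl mA (k - a) (ih b mA)).
apply: le_Rintegral => //.
- exact: (integrableZl mA (b - a) (ih k mA)).
- exact: (integrableD mA (integrableZl mA (b - k) (ih a mA)) (integrableZl mA (k - a) (ih b mA))).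
- by move=> w _; exact: hinge_cvx.
Qed.

(** This bound and the next one say that the one-sided derivatives of the
    potential are the two versions of the distribution function. *)
Lemma pot_slope_lo A s t : measurable A -> s <= t ->
  (t - s) * fine (m (A `&` Z @^-1` `]-oo, s])) <= pot m A Z t - pot m A Z s.
Proof.
move=> mA st; rewrite -Rintegral_indic//; last exact: mZB.
rewrite /pot -RintegralB//; [|exact: ih..]; apply: le_Rintegral => //.
- by apply: (integrableZl mA (t - s) (integrable_indicS m mA (mZB _))).
- exact: (integrableB mA (ih t mA) (ih s mA)).
- by move=> w _; exact: hinge_slope_lo.
Qed.

Lemma pot_slope_hi A s t : measurable A -> s <= t ->
  pot m A Z t - pot m A Z s <= (t - s) * fine (m (A `&` Z @^-1` `]-oo, t[)).
Proof.
move=> mA st; rewrite -Rintegral_indic//; last exact: mZB.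
rewrite /pot -RintegralB//; [|exact: ih..]; apply: le_Rintegral => //.
- exact: (integrableB mA (ih t mA) (ih s mA)).
- by apply: (integrableZl mA (t - s) (integrable_indicS m mA (mZB _))).
- by move=> w _; exact: hinge_slope_hi.
Qed.

Lemma fine_measure_le A B : measurable A -> measurable B -> A `<=` B -> fine (m A) <= fine (m B).
Proof.
by move=> mA mB AB; apply: fine_le; rewrite ?fin_num_measure//; apply: le_measure; rewrite ?inE.
Qed.

Lemma pot_nd A s t : measurable A -> s <= t -> pot m A Z s <= pot m A Z t.
Proof.
move=> mA st; have := pot_slope_lo mA st.
suff : 0 <= (t - s) * fine (m (A `&` Z @^-1` `]-oo, s])) by lra.
by apply: mulr_ge0; [lra|exact: fine_ge0].
Qed.

Lemma pot_lip A : measurable A -> lip (fine (m setT)) (pot m A Z).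
Proof.
move=> mA s t st; rewrite ger0_norm; last by have := pot_nd mA st; lra.
apply: le_trans (pot_slope_hi mA st) _; rewrite mulrC ler_wpM2r ?subr_ge0//.
by apply: fine_measure_le => //; apply: measurableI => //; exact: mZB.
Qed.

Lemma potU A B k : measurable A -> measurable B -> A `&` B = set0 ->
  pot m (A `|` B) Z k = pot m A Z k + pot m B Z k.
Proof.
move=> mA mB AB; rewrite /pot Rintegral_setU//; last by rewrite disj_set2E; apply/eqP.
by apply: ih; exact: measurableU.
Qed.

Lemma pot_setC A k : measurable A -> pot m setT Z k = pot m A Z k + pot m (~` A) Z k.
Proof. by move=> mA; rewrite -potU ?setUv ?setICr//; exact: measurableC. Qed.

Lemma pot_small A e : measurable A -> 0 < e -> exists k0, forall k, k <= k0 -> pot m A Z k <= e.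
Proof.
move=> mA e0.
have [] := @dominated_convergence _ _ _ m A mA
  (fun n w => (hinge (- n%:R) (Z w))%:E) (cst 0%E) (fun w => (hinge 0 (Z w))%:E).
- by move=> n; exact: measurable_int (ih _ mA).
- by [].
- apply: aeW => w Aw; apply: cvg_near_cst.
  near=> n; rewrite /hinge; congr (_%:E); apply/max_idPr.
  rewrite subr_le0 lerNl.
  by near: n; exact: nbhs_infty_ger.
- exact: ih.
- apply: aeW => w n Aw /=; rewrite lee_fin ger0_norm ?hinge_ge0//.
  rewrite /hinge ge_max !le_max lexx orbT andbT.
  have : 0 <= (n%:R : R) by []. by move=> n0; apply/orP; left; lra.
move=> _ _; rewrite integral0 => h.
have {h}/cvgr_le h : (pot m A Z (- n%:R)) @[n --> \oo] --> (0 : R).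
  by have := fine_cvg h; apply.
have /h [n _ hn] : 0 < e by [].
exists (- n%:R) => k kn; apply: le_trans (hn n _) => //=; exact: pot_nd.
Unshelve. all: by end_near. Qed.

(** An interval without mass is an interval where the distribution function,
    hence the slope of the potential, is constant. *)
Lemma pot_affine A a b : measurable A -> m (A `&` Z @^-1` `]a, b[) = 0%E ->
  forall s z t, a <= s -> s <= z -> z <= t -> t <= b ->
    (t - s) * pot m A Z z = (t - z) * pot m A Z s + (z - s) * pot m A Z t.
Proof.
move=> mA m0 s z t as_ sz zt tb.
pose c := fine (m (A `&` Z @^-1` `]-oo, a])).
have lo x y : a <= x -> x <= y -> y <= b -> pot m A Z y - pot m A Z x = (y - x) * c.
  move=> ax xy yb; apply/eqP; rewrite eq_le; apply/andP; split.
    apply: le_trans (pot_slope_hi mA xy) _; rewrite ler_wpM2l ?subr_ge0//.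
    have -> : c = fine (m (A `&` Z @^-1` `]-oo, a]) + m (A `&` Z @^-1` `]a, b[)).
      by rewrite m0 adde0.
    rewrite -measureU//; [|by apply: measurableI => //; exact: mZB..|]; last first.
      apply/seteqP; split => // w [[_ /=]]; rewrite in_itv/= => wa [_ /=].
      by rewrite in_itv/= => /andP[]; lra.
    apply: fine_measure_le.
    - by apply: measurableI => //; exact: mZB.
    - by apply: measurableU; apply: measurableI => //; exact: mZB.
    move=> w [Aw /=]; rewrite !in_itv/= => wy.
    by have [wa|wa] := leP (Z w) a; [left|right]; split; rewrite //= ?in_itv/= ?wa//=; lra.
  apply: le_trans (pot_slope_lo mA xy); rewrite ler_wpM2l ?subr_ge0//.
  apply: fine_measure_le.
  - by apply: measurableI => //; exact: mZB.
  - by apply: measurableI => //; exact: mZB.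
  by move=> w [Aw /=]; rewrite !in_itv/= => wa; split; rewrite //= ?in_itv/=; lra.
have := lo s z as_ sz ltac:(lra); have := lo z t ltac:(lra) zt tb.
have -> : pot m A Z t = pot m A Z z + (t - z) * c; last by nra.
by have := lo z t ltac:(lra) zt tb; lra.
Qed.

Lemma pot_affine_null A a b p q : measurable A -> a < p -> p <= q -> q < b ->
  (forall s z t, a <= s -> s <= z -> z <= t -> t <= b ->
    (t - s) * pot m A Z z = (t - z) * pot m A Z s + (z - s) * pot m A Z t) ->
  m (A `&` Z @^-1` `[p, q]) = 0%E.
Proof.
move=> mA ap pq qb aff.
have mI (i : interval R) : measurable (A `&` Z @^-1` [set` i]) by apply: measurableI => //; exact: mZB.
have qp : fine (m (A `&` Z @^-1` `]-oo, q])) <= fine (m (A `&` Z @^-1` `]-oo, p[)).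
  have h1 := pot_slope_lo mA (ltW qb); have h2 := pot_slope_hi mA (ltW ap).
  have pb : p <= b by lra.
  have e1 := aff a p b (lexx _) (ltW ap) pb (lexx _).
  have aq : a <= q by lra.
  have e2 := aff a q b (lexx _) aq (ltW qb) (lexx _).
  have bq0 : 0 < b - q by lra.
  have pa0 : 0 < p - a by lra.
  rewrite -(ler_pM2l bq0) -(ler_pM2l pa0).
  have : (p - a) * (pot m A Z b - pot m A Z q) = (b - q) * (pot m A Z p - pot m A Z a).
    apply: (mulfI (lt0r_neq0 (_ : 0 < b - a))); first by lra.
    by nra.
  by nra.
have E : A `&` Z @^-1` `]-oo, q] = (A `&` Z @^-1` `]-oo, p[) `|` (A `&` Z @^-1` `[p, q]).
  apply/seteqP; split => w /=; rewrite !in_itv/=.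
    by move=> [Aw wq]; have [wp|wp] := ltP (Z w) p; [left|right]; rewrite ?wp.
  by move=> [[Aw wp]|[Aw /andP[_ ->]]] => //; split => //; lra.
have : (m (A `&` Z @^-1` `]-oo, q]) = m (A `&` Z @^-1` `]-oo, p[) + m (A `&` Z @^-1` `[p, q]))%E.
  rewrite E measureU//; apply/seteqP; split => // w [[_ /=]]; rewrite in_itv/= => wa [_ /=].
  by rewrite in_itv/= => /andP[]; lra.
move=> /(congr1 fine); rewrite fineD ?fin_num_measure// => e.
apply/eqP; rewrite -fine_eq0 ?fin_num_measure//; apply/eqP.
have : 0 <= fine (m (A `&` Z @^-1` `[p, q])) by apply: fine_ge0.
by lra.
Qed.

End theory.

(** Put-call parity; the last term vanishes as k grows, which identifies the
    asymptote of the potential. *)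
Lemma pot_reflect m Z A k : measurable A -> m.-integrable setT (EFin \o Z) ->
  pot m A Z k = k * fine (m A) - \int[m]_(w in A) Z w + pot m A (fun w => - Z w) (- k).
Proof.
move=> mA iZ; have mZ : measurable_fun setT Z by apply/measurable_EFinP; exact: measurable_int iZ.
have iZA : m.-integrable A (EFin \o Z) by exact: integrableS iZ.
have ik : m.-integrable A (EFin \o cst k) by exact: finite_measure_integrable_cst.
have iNZ : hinge_integrable m (fun w => - Z w).
  by apply: integrable_hinge; exact: (integrableN iZ).
rewrite -(Rintegral_cst m mA) -RintegralB// /pot -RintegralD//; last 2 first.
- exact: (integrableB mA ik iZA).
- exact: integrableS (iNZ (- k)).
apply: eq_Rintegral => w _; rewrite /hinge opprK.
have [|] := leP (k - Z w) 0; have [|] := leP (- k + Z w) 0; lra.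
Qed.

End potential.

(** * A potential determines its measure *)

Section law.
Context d d' (T : measurableType d) (T' : measurableType d') (R : realType).
Variables (m : {finite_measure set T -> \bar R}) (A : set T) (Z : T -> T').

(** The proofs of measurability are arguments so that the measure structure can
    be inferred from the term. *)
Definition law of measurable A & measurable_fun setT Z :=
  fun B : set T' => m (A `&` Z @^-1` B).

Hypotheses (mA : measurable A) (mZ : measurable_fun setT Z).

Let law0 : law mA mZ set0 = 0%E.
Proof. by rewrite /law preimage_set0 setI0 measure0. Qed.

Let law_ge0 B : (0 <= law mA mZ B)%E.
Proof. by rewrite /law. Qed.

Let mZB B : measurable B -> measurable (A `&` Z @^-1` B).
Proof. by move=> mB; apply: measurableI => //; rewrite -[X in measurable X]setTI; exact: mZ. Qed.

Let law_sigma : semi_sigma_additive (law mA mZ).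
Proof.
move=> F mF tF mUF; rewrite /law preimage_bigcup setI_bigcupr.
apply: measure_semi_sigma_additive.
- by move=> n; exact: mZB.
- apply/trivIsetP => /= i j _ _ ij; rewrite setIACA -preimage_setI.
  by move/trivIsetP : tF => /(_ _ _ _ _ ij) ->//; rewrite preimage_set0 setI0.
- by rewrite -setI_bigcupr -preimage_bigcup; exact: mZB.
Qed.

HB.instance Definition _ := isMeasure.Build _ _ _ (law mA mZ) law0 law_ge0 law_sigma.

Let law_fin : fin_num_fun (law mA mZ).
Proof. by move=> B mB; rewrite /law fin_num_measure//; exact: mZB. Qed.

HB.instance Definition _ := Measure_isFinite.Build _ _ _ (law mA mZ) law_fin.

End law.

Section rays.
Context {R : realType}.

(** Rays determine the bounded half-open intervals, a generating family that is
    stable under intersection. *)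
Lemma measure_eq_rays (m1 m2 : {finite_measure set R -> \bar R}) :
  (forall s : R, fine (m1 `]-oo, s]%classic) = fine (m2 `]-oo, s]%classic)) ->
  forall B : set R, measurable B -> m1 B = m2 B.
Proof.
move=> e.
have e' (s : R) : m1 `]-oo, s]%classic = m2 `]-oo, s]%classic.
  by rewrite -[LHS]fineK ?fin_num_measure// e fineK ?fin_num_measure.
apply: (measure_unique (@ocitv R) (fun n => `]- n%:R, n%:R]%classic)).
- by [].
- exact: ocitvI.
- by move=> n; exact: is_ocitv.
- exact: bigcup_itvT.
- move=> _ [[a b] _ <-] /=.
  have [ab|ba] := leP a b; last first.
    by rewrite set_itv_ge ?measure0// bnd_simp -leNgt ltW.
  have -> : `]a, b]%classic = `]-oo, b] `\` `]-oo, a].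
    by rewrite -[RHS]setCK setCD setCitvl setUC -[LHS]setCK setCitv.
  rewrite !measureD ?setIidr//; try exact: subset_itvl.
  - by congr (_ - _)%E; exact: e'.
  - by rewrite -ge0_fin_numE// fin_num_measure.
  - by rewrite -ge0_fin_numE// fin_num_measure.
- by move=> n; rewrite -ge0_fin_numE// fin_num_measure.
Qed.

End rays.

Section pot_injective.
Context d1 d2 (T1 : measurableType d1) (T2 : measurableType d2) (R : realType).

(** Comparing the slopes of the common potential on ]s, s + 1/(n+1)[ bounds the
    first distribution function at s by the second one slightly to the right of
    s; conclude by right continuity. *)
Lemma pot_inj_le (m1 : {finite_measure set T1 -> \bar R}) (A1 : set T1) (Z1 : T1 -> R)
    (m2 : {finite_measure set T2 -> \bar R}) (A2 : set T2) (Z2 : T2 -> R) :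
  measurable A1 -> measurable_fun setT Z1 -> hinge_integrable m1 Z1 ->
  measurable A2 -> measurable_fun setT Z2 -> hinge_integrable m2 Z2 ->
  pot m1 A1 Z1 = pot m2 A2 Z2 ->
  forall s, fine (m1 (A1 `&` Z1 @^-1` `]-oo, s])) <= fine (m2 (A2 `&` Z2 @^-1` `]-oo, s])).
Proof.
move=> mA1 mZ1 iZ1 mA2 mZ2 iZ2 e s.
have h n : fine (m1 (A1 `&` Z1 @^-1` `]-oo, s])) <=
    fine (law m2 mA2 mZ2 `]-oo, (s + n.+1%:R^-1)]%classic).
  have n0 : 0 < n.+1%:R^-1 :> R by [].
  have st : s <= s + n.+1%:R^-1 by rewrite lerDl ltW.
  have h1 := pot_slope_lo mZ1 iZ1 mA1 st; have h2 := pot_slope_hi mZ2 iZ2 mA2 st.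
  rewrite e in h1; have := le_trans h1 h2.
  have -> : s + n.+1%:R^-1 - s = n.+1%:R^-1 by ring.
  rewrite ler_pM2l// => /le_trans; apply; rewrite /law.
  have mI B : measurable B -> measurable (A2 `&` Z2 @^-1` B).
    by move=> mB; apply: measurableI => //; rewrite -[X in measurable X]setTI; exact: mZ2.
  apply: fine_measure_le; [exact: mI|exact: mI|].
  by apply: setIS => w /=; rewrite !in_itv/= => /ltW.
have cv : law m2 mA2 mZ2 `]-oo, (s + n.+1%:R^-1)]%classic @[n --> \oo] -->
    law m2 mA2 mZ2 (\bigcap_n `]-oo, (s + n.+1%:R^-1)]%classic).
  apply: (@nonincreasing_cvg_mu _ _ _ _ (fun n : nat => `]-oo, (s + n.+1%:R^-1)]%classic)).
  - by rewrite -ge0_fin_numE// fin_num_measure.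
  - by [].
  - by apply: bigcap_measurable.
  - move=> p q pq; apply/subsetPset; apply: subset_itvl.
    by rewrite bnd_simp lerD2l lef_pV2 ?posrE// ler_nat.
rewrite -itvNycEbigcap in cv.
rewrite -[X in _ --> X]fineK ?fin_num_measure// in cv; have {cv}fcv := @fine_cvg _ _ eventually _ _ _ cv.
by apply: (cvgr_to_ge (fcv _)); exact: nearW.
Qed.

End pot_injective.

Lemma pot_inj d1 d2 (T1 : measurableType d1) (T2 : measurableType d2) (R : realType)
    (m1 : {finite_measure set T1 -> \bar R}) (A1 : set T1) (Z1 : T1 -> R)
    (m2 : {finite_measure set T2 -> \bar R}) (A2 : set T2) (Z2 : T2 -> R) :
  measurable A1 -> measurable_fun setT Z1 -> hinge_integrable m1 Z1 ->
  measurable A2 -> measurable_fun setT Z2 -> hinge_integrable m2 Z2 ->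
  pot m1 A1 Z1 = pot m2 A2 Z2 ->
  forall B : set R, measurable B -> m1 (A1 `&` Z1 @^-1` B) = m2 (A2 `&` Z2 @^-1` B).
Proof.
move=> mA1 mZ1 iZ1 mA2 mZ2 iZ2 e B mB.
apply: (measure_eq_rays (m1 := law m1 mA1 mZ1) (m2 := law m2 mA2 mZ2)) => // s.
by apply/eqP; rewrite eq_le; apply/andP; split; apply: pot_inj_le.
Qed.

(** * Convex functions as potentials *)

(** The difference of f and g varies by at most (G t - G s)(t - s) on [s, t].
    Cutting [a, b] into n equal pieces and summing, the difference
    changes in total by at most (G b - G a)(b - a)/n. *)
Lemma slope_increment_unique {R : realType} (f g G : R -> R) (a b : R) :
  a <= b ->
  (forall s t, a <= s -> s <= t -> t <= b -> G s * (t - s) <= f t - f s <= G t * (t - s)) ->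
  (forall s t, a <= s -> s <= t -> t <= b -> G s * (t - s) <= g t - g s <= G t * (t - s)) ->
  f b - f a = g b - g a.
Proof.
move=> ab hf hg.
pose D x := f x - g x.
suff : D b - D a = 0 by rewrite /D; lra.
have key n : `|D b - D a| <= (G b - G a) * (b - a) * n.+1%:R^-1.
  have n0 : 0 < n.+1%:R :> R by [].
  pose x i := a + i%:R * ((b - a) / n.+1%:R).
  have x0 : x 0%N = a by rewrite /x mul0r addr0.
  have xn : x n.+1 = b by rewrite /x mulrCA divff ?mulr1 ?gt_eqF//; lra.
  have dx i : x i.+1 - x i = (b - a) / n.+1%:R by rewrite /x -addn1 natrD; ring.
  have d0 : 0 <= (b - a) / n.+1%:R by apply: divr_ge0; lra.
  have xm i j : (i <= j)%N -> x i <= x j.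
    by move=> ij; rewrite /x lerD2l ler_wpM2r// ler_nat.
  have -> : D b - D a = \sum_(0 <= i < n.+1) (D (x i.+1) - D (x i)).
    by rewrite telescope_sumr// x0 xn.
  apply: le_trans (ler_norm_sum _ _ _) _.
  have -> : (G b - G a) * (b - a) * n.+1%:R^-1 =
      \sum_(0 <= i < n.+1) (G (x i.+1) - G (x i)) * ((b - a) / n.+1%:R).
    by rewrite -mulr_suml telescope_sumr// x0 xn mulrA.
  apply: ler_sum_nat => i /andP[_ ilt].
  have ai : a <= x i by rewrite -x0; exact: xm.
  have ib : x i.+1 <= b by rewrite -xn; exact: xm.
  have /andP[? ?] := hf _ _ ai (xm _ _ (leqnSn i)) ib.
  have /andP[? ?] := hg _ _ ai (xm _ _ (leqnSn i)) ib.
  by rewrite -(dx i) /D ler_norml; apply/andP; split; lra.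
apply/eqP; rewrite -normr_le0; apply/ler_addgt0Pl => e e0; rewrite addr0.
set c := (G b - G a) * (b - a) in key.
have [c0|c0] := leP c 0.
  by apply: le_trans (key 0%N) _; rewrite invr1 mulr1; lra.
have [n hn] : exists n : nat, c / e < n.+1%:R.
  exists (Num.bound (c / e)); apply: lt_le_trans (archi_boundP _) _; first by apply: divr_ge0; lra.
  by rewrite ler_nat.
apply: le_trans (key n) _.
by rewrite ler_pdivrMr// mulrC -ler_pdivrMr// ltW.
Qed.

Section representation.
Context {R : realType}.
Variables (E : R -> R) (L : R).
Hypotheses (cE : cvx E) (lE : lip L E).
Hypothesis E0 : forall e : R, 0 < e -> exists k0, forall k, k <= k0 -> `|E k| <= e.

(* the right derivative of E *)
Let G y := inf [set (E (y + h) - E y) / h | h in [set h | 0 < h]].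

Let G_inf y : has_inf [set (E (y + h) - E y) / h | h in [set h | 0 < h]].
Proof.
split; first by exists ((E (y + 1) - E y) / 1); exists 1 => //=.
exists (- L) => _ [h /= h0 <-]; rewrite ler_pdivlMr//.
have := @lE y (y + h); rewrite lerDl ltW// => /(_ erefl).
by rewrite addrAC subrr add0r ler_norml mulNr => /andP[].
Qed.

Let G_le s t : s <= t -> G s * (t - s) <= E t - E s.
Proof.
rewrite le_eqVlt => /predU1P[->|st]; first by rewrite !subrr mulr0.
have st0 : 0 < t - s by lra.
rewrite -ler_pdivlMr//; apply: ge_inf; first by case: (G_inf s).
by exists (t - s) => //; rewrite addrCA subrr addr0.
Qed.

Let le_G s t : s <= t -> E t - E s <= G t * (t - s).
Proof.
rewrite le_eqVlt => /predU1P[->|st]; first by rewrite !subrr mulr0.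
have st0 : 0 < t - s by lra.
rewrite -ler_pdivrMr//; apply: lb_le_inf; first by case: (G_inf t).
move=> _ [h /= h0 <-]; rewrite ler_pdivrMr// mulrAC ler_pdivlMr//.
by have := cE (ltW st) (_ : t <= t + h); rewrite lerDl ltW// => /(_ erefl); lra.
Qed.

Let G_nd : {homo G : s t / s <= t}.
Proof.
move=> s t; rewrite le_eqVlt => /predU1P[->//|st].
have st0 : 0 < t - s by lra.
by rewrite -(ler_pM2r st0); apply: le_trans (G_le (ltW st)) (le_G (ltW st)).
Qed.

Let G_small e : 0 < e -> exists k0, forall k, k <= k0 -> G k <= e.
Proof.
move=> e0; have [|k0 hk] := E0 (e := e / 2); first by lra.
exists (k0 - 1) => k kk0; have := @G_le k (k + 1); rewrite lerDl => /(_ ler01).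
have := hk k ltac:(lra); have := hk (k + 1) ltac:(lra).
by rewrite !ler_norml => /andP[? ?] /andP[? ?]; lra.
Qed.

Let G_ge0 y : 0 <= G y.
Proof.
apply/ler_addgt0Pr => e e0.
have [|k1 hk1] := E0 (e := e / 2); first by lra.
pose j := Num.min k1 y - 1.
have jk1 : j <= k1.
  by have : Num.min k1 y <= k1 by [rewrite ge_min lexx]; rewrite /j; lra.
have jy : j <= y.
  by have : Num.min k1 y <= y by [rewrite ge_min lexx orbT]; rewrite /j; lra.
have g1 := @le_G (j - 1) j ltac:(lra).
have g2 := hk1 j jk1. have g3 := hk1 (j - 1) ltac:(lra).
have g4 := @G_nd j y jy.
by move: g2 g3; rewrite !ler_norml => /andP[? ?] /andP[? ?]; lra.
Qed.

Let G_leL y : G y <= L.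
Proof.
have := @G_le y (y + 1); rewrite lerDl => /(_ ler01).
have := @lE y (y + 1); rewrite lerDl => /(_ ler01).
by rewrite ler_norml => /andP[? ?]; lra.
Qed.

Let G_rc : right_continuous G.
Proof.
move=> y; apply/cvgrPdist_le => e e0.
have [|_ [h /= h0 <-] hh] := @inf_adherent _ _ (e / 2) _ (G_inf y); first by lra.
rewrite -/(G y) ltr_pdivrMr// in hh.
near=> z.
have yz : y < z by near: z; exact: nbhs_right_gt.
have zh : z < y + h / 2 by near: z; apply: nbhs_right_lt; rewrite ltrDl; lra.
have := G_nd (ltW yz) => h1.
rewrite distrC ger0_norm; last by lra.
have h2 := @G_le z (y + h) ltac:(lra).
have h3 := @G_le y z (ltW yz).
have zh0 : 0 < y + h - z by lra.
by rewrite -(ler_pM2r zh0); nra.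
Unshelve. all: by end_near. Qed.

#[local] HB.instance Definition _ := isCumulative.Build R _ R G G_nd G_rc.

Let lsG := lebesgue_stieltjes_measure G.

Let lsG_oc a b : a <= b -> lsG `]a, b]%classic = (G b - G a)%:E.
Proof.
move=> ab; rewrite /lsG /lebesgue_stieltjes_measure /measure_extension/=.
by rewrite measurable_mu_extE/= ?wlength_itv_bnd//; exact: is_ocitv.
Qed.

(* the Stieltjes measure of G, carried over to the Borel structure of R *)
Let mG (B : set R) := lsG B.

Let mG0 : mG set0 = 0%E. Proof. exact: measure0. Qed.
Let mG_ge0 B : (0 <= mG B)%E. Proof. exact: measure_ge0. Qed.
Let mG_sigma : semi_sigma_additive mG.
Proof. exact: (@measure_semi_sigma_additive _ _ _ (lebesgue_stieltjes_measure G)). Qed.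

#[local] HB.instance Definition _ := isMeasure.Build _ R _ mG mG0 mG_ge0 mG_sigma.

Let mG_ray s : mG `]-oo, s]%classic = (G s)%:E.
Proof.
rewrite itvNybndEbigcup.
have h1 : mG `]-n%:R, s]%classic @[n --> \oo] --> (G s)%:E.
  suff : ((G s)%:E - (G (-n%:R))%:E)%E @[n --> \oo] --> (G s)%:E.
    apply: cvg_trans; apply: near_eq_cvg; near=> n.
    rewrite /mG lsG_oc//.
    by rewrite lerNl; near: n; exact: nbhs_infty_ger.
  apply: cvg_EFin; first exact: nearW.
  rewrite -[X in _ --> X]subr0; apply: (@cvgB _ R^o); first exact: cvg_cst.
  apply/cvgrPdist_le => e e0; have [k0 hk] := G_small e0.
  near=> n; rewrite sub0r normrN ger0_norm//; apply: hk.
  by rewrite lerNl; near: n; exact: nbhs_infty_ger.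
have h2 : mG `]- n%:R, s]%classic @[n --> \oo] --> mG (\bigcup_n `]-n%:R, s]%classic).
  apply: (@nondecreasing_cvg_mu _ R _ mG (fun n => `]- n%:R, s]%classic)) => //.
    exact: bigcup_measurable.
  by move=> *; apply/subsetPset/subset_itv; rewrite leBSide//= lerN2 ler_nat.
by apply: cvg_unique h2 h1.
Unshelve. all: end_near. Qed.

Let mG_fin : fin_num_fun mG.
Proof.
apply: lty_fin_num_fun.
have h : mG `]-oo, n%:R]%classic @[n --> \oo] --> mG (\bigcup_n `]-oo, n%:R]%classic).
  apply: (@nondecreasing_cvg_mu _ R _ mG (fun n => `]-oo, n%:R]%classic)) => //.
    exact: bigcup_measurable.
  by move=> p q pq; apply/subsetPset; apply: subset_itvl; rewrite bnd_simp ler_nat.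
have -> : [set: R] = \bigcup_n `]-oo, n%:R]%classic.
  apply/esym; rewrite -subTset => x _; exists (Num.bound `|x|) => //=.
  rewrite in_itv/=; apply/ltW/(le_lt_trans (ler_norm x)).
  exact: archi_boundP.
apply: le_lt_trans (ltry L).
apply: (cvge_to_le h); apply: nearW => n.
by rewrite mG_ray lee_fin.
Qed.

#[local] HB.instance Definition _ := Measure_isFinite.Build _ R _ mG mG_fin.

(* truncation from below keeps every hinge bounded until E is known to be the
   potential, which gives the missing integrability *)
Let Zn n (y : R) := Num.max y (- n%:R).

Let mZn n : measurable_fun setT (Zn n).
Proof. exact: measurable_maxr. Qed.

Let iZn n : hinge_integrable mG (Zn n).
Proof.
move=> k; apply: (@le_integrable _ _ _ _ _ measurableT _ (EFin \o cst (`|k| + n%:R))).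
- apply/measurable_EFinP; apply: measurableT_comp; first exact: measurable_hinge.
  exact: mZn.
- move=> y _ /=; rewrite lee_fin ger0_norm ?hinge_ge0// ger0_norm ?addr_ge0//.
  rewrite /hinge ge_max addr_ge0// andbT.
  have : - n%:R <= Zn n y by rewrite /Zn le_max lexx orbT.
  by have := ler_norm k; lra.
- exact: finite_measure_integrable_cst.
Qed.

Let pot_Zn n k : - n%:R <= k -> pot mG setT (Zn n) k = E k - E (- n%:R).
Proof.
move=> nk.
have -> : pot mG setT (Zn n) k = pot mG setT (Zn n) k - pot mG setT (Zn n) (- n%:R).
  suff -> : pot mG setT (Zn n) (- n%:R) = 0 by rewrite subr0.
  rewrite /pot (@eq_Rintegral _ _ _ _ _ (fun=> 0)); last first.
    move=> y _; rewrite /hinge; apply/max_idPr.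
    have : - n%:R <= Zn n y by rewrite /Zn le_max lexx orbT.
    lra.
  by rewrite Rintegral_cst// mul0r.
have mr (s : R) : - n%:R <= s -> mG (setT `&` Zn n @^-1` `]-oo, s]) = (G s)%:E.
  move=> ns; rewrite -mG_ray setTI; congr mG; apply/seteqP; split => y /=;
    by rewrite !in_itv/= /Zn ge_max ns andbT.
apply: (slope_increment_unique (G := G)) => // [s t ns st tk|s t ns st tk].
  apply/andP; split.
    have -> : G s = fine (mG (setT `&` Zn n @^-1` `]-oo, s])) by rewrite mr.
    by rewrite mulrC; exact: (pot_slope_lo (mZn n) (iZn n) measurableT st).
  apply: le_trans (pot_slope_hi (mZn n) (iZn n) measurableT st) _.
  rewrite mulrC ler_wpM2r ?subr_ge0//.
  have -> : G t = fine (mG (setT `&` Zn n @^-1` `]-oo, t])) by rewrite mr//; lra.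
  have mI B : measurable B -> measurable (setT `&` Zn n @^-1` B) by exact: mZn.
  apply: fine_measure_le; [exact: mI|exact: mI|].
  by apply: setIS => w /=; rewrite !in_itv/= => /ltW.
by rewrite G_le//= le_G.
Qed.

(** Every convex Lipschitz function vanishing at -oo is a potential: take the
    Stieltjes measure of its right derivative. Both E and the potential of that
    measure have increments controlled by the same slopes, hence the same
    increments. *)
Lemma pot_surjective : exists m : {finite_measure set R -> \bar R},
  hinge_integrable m id /\ pot m setT id = E.
Proof.
exists mG.
have key k : (\int[mG]_y (hinge k y)%:E = (E k)%:E)%E.
  have h1 : (\int[mG]_y (hinge k (Zn n y))%:E)%E @[n --> \oo] --> (\int[mG]_y (hinge k y)%:E)%E.
    have -> : (fun y => (hinge k y)%:E) = (fun y => limn (fun n => (hinge k (Zn n y))%:E)).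
      apply/funext => y; apply/esym/cvg_lim => //; apply: cvg_near_cst.
      near=> n; rewrite /Zn; congr (hinge _ _)%:E; apply/max_idPl.
      by rewrite lerNl; near: n; exact: nbhs_infty_ger.
    apply: cvg_monotone_convergence => //.
    - by move=> n; exact: measurable_int (iZn n k).
    - by move=> n y _; rewrite lee_fin hinge_ge0.
    - move=> y _ n p np; rewrite lee_fin /hinge.
      have : Zn p y <= Zn n y.
        rewrite /Zn ge_max !le_max lexx/= lerN2 ler_nat np orbT//.
      move=> ?; rewrite ge_max !le_max lexx orbT andbT; apply/orP; left; lra.
  have h2 : (\int[mG]_y (hinge k (Zn n y))%:E)%E @[n --> \oo] --> (E k)%:E.
    suff : (E k - E (- n%:R))%:E @[n --> \oo] --> (E k)%:E.
      apply: cvg_trans; apply: near_eq_cvg; near=> n.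
      rewrite -pot_Zn.
        rewrite /pot /Rintegral fineK//; apply: integrable_fin_num => //; exact: iZn.
      by rewrite lerNl; near: n; exact: nbhs_infty_ger.
    apply: cvg_EFin; first exact: nearW.
    rewrite -[X in _ --> X]subr0; apply: (@cvgB _ R^o); first exact: cvg_cst.
    apply/cvgrPdist_le => e e0; have [k0 hk] := E0 e0.
    near=> n; rewrite sub0r normrN; apply: hk.
    by rewrite lerNl; near: n; exact: nbhs_infty_ger.
  by apply: cvg_unique h1 h2.
split.
  move=> k; apply/integrableP; split.
    by apply/measurable_EFinP; exact: measurable_hinge.
  under eq_integral do rewrite /= ger0_norm ?hinge_ge0//.
  by rewrite key ltry.
by apply/funext => k; rewrite /pot /Rintegral key.
Unshelve. all: end_near. Qed.

End representation.

(** * Comparison of measures through their potentials *)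

Section measure_add_finite.
Context d (T : measurableType d) (R : realType).
Variables (m1 m2 : {finite_measure set T -> \bar R}).

Definition finite_add : set T -> \bar R := measure_add m1 m2.

HB.instance Definition _ := Measure.copy finite_add
  (msum (fun n => if n is 0%N then (m1 : {measure set T -> \bar R}) else m2) 2).

Let finite_add_fin : fin_num_fun finite_add.
Proof. by move=> B mB; rewrite /finite_add measure_addE fin_numD !fin_num_measure. Qed.

HB.instance Definition _ := Measure_isFinite.Build _ _ _ finite_add finite_add_fin.

Lemma hinge_integrable_add Z : hinge_integrable m1 Z -> hinge_integrable m2 Z ->
  hinge_integrable finite_add Z.
Proof.
move=> i1 i2 k; have /integrableP[mh h1] := i1 k; have /integrableP[_ h2] := i2 k.
apply/integrableP; split => //.
rewrite ge0_integral_measure_add//; first exact: lte_add_pinfty.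
exact: measurableT_comp.
Qed.

Lemma pot_add Z : hinge_integrable m1 Z -> hinge_integrable m2 Z ->
  forall k, pot finite_add setT Z k = pot m1 setT Z k + pot m2 setT Z k.
Proof.
move=> i1 i2 k; rewrite /pot /Rintegral ge0_integral_measure_add//.
- by rewrite fineD//; exact: integrable_fin_num.
- by move=> w _; rewrite lee_fin hinge_ge0.
- exact: measurable_int (i1 k).
Qed.

End measure_add_finite.

Section pot_order.
Context {R : realType}.

(** The convex difference of the two potentials is the potential of a positive
    measure r, and potentials determine measures. *)
Lemma pot_cvx_sub_le (m1 m2 : {finite_measure set R -> \bar R}) :
  hinge_integrable m1 id -> hinge_integrable m2 id ->
  cvx (fun k => pot m2 setT id k - pot m1 setT id k) ->
  exists r : {finite_measure set R -> \bar R},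
    forall B, measurable B -> m2 B = (m1 B + r B)%E.
Proof.
move=> i1 i2 c.
have mid : measurable_fun setT (@id R) by [].
have l := lipB (pot_lip mid i2 measurableT) (pot_lip mid i1 measurableT).
have [|r [ir er]] := pot_surjective c l.
  move=> e e0.
  have [k1 h1] := pot_small mid i1 measurableT e0.
  have [k2 h2] := pot_small mid i2 measurableT e0.
  exists (Num.min k1 k2) => k; rewrite le_min => /andP[/h1 kk1 /h2 kk2].
  have := pot_ge0 m1 id setT k; have := pot_ge0 m2 id setT k => ? ?.
  by rewrite ler_norml; apply/andP; split; lra.
exists r => B mB.
have ia := hinge_integrable_add i1 ir.
have : pot m2 setT id = pot (finite_add m1 r) setT id.
  by apply/funext => k; rewrite pot_add// er; ring.
move=> /(pot_inj measurableT mid i2 measurableT mid ia) /(_ _ mB).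
by rewrite !setTI /= preimage_id /finite_add measure_addE.
Qed.

Lemma integrable_le_measure (m1 m2 r : {finite_measure set R -> \bar R}) (f : R -> \bar R) :
  (forall B, measurable B -> m2 B = (m1 B + r B)%E) ->
  m2.-integrable setT f -> m1.-integrable setT f.
Proof.
move=> e /integrableP[mf h]; apply/integrableP; split => //.
apply: le_lt_trans h.
have -> : (\int[m2]_x `|f x| = \int[measure_add m1 r]_x `|f x|)%E.
  by apply: eq_measure_integral => B mB _; exact: (etrans (e B mB) (esym (measure_addE m1 r B))).
rewrite ge0_integral_measure_add//; last exact: measurableT_comp.
by rewrite leeDl// integral_ge0.
Qed.

End pot_order.

Section asymptotics.
Context {R : realType}.

Lemma affine_small (a b : R) :
  (forall e, 0 < e -> exists k0, forall k, k0 <= k -> `|a * k - b| <= e) -> a = 0 /\ b = 0.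
Proof.
move=> h.
have a0 : a = 0.
  apply/eqP; rewrite -normr_le0; apply/ler_addgt0Pl => e e0; rewrite addr0.
  have [|k0 hk] := h (e / 2); first by lra.
  have := hk k0 (lexx _); have := hk (k0 + 1) ltac:(lra).
  by rewrite !ler_norml => /andP[? ?] /andP[? ?]; apply/andP; split; lra.
split => //; apply/eqP; rewrite -normr_le0; apply/ler_addgt0Pl => e e0; rewrite addr0.
have [k0 hk] := h e e0.
by have := hk k0 (lexx _); rewrite a0 mul0r sub0r normrN.
Qed.

Context d1 d2 (T1 : measurableType d1) (T2 : measurableType d2).
Variables (m1 : {finite_measure set T1 -> \bar R}) (m2 : {finite_measure set T2 -> \bar R}).
Variables (A1 : set T1) (A2 : set T2) (Z1 : T1 -> R) (Z2 : T2 -> R).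
Hypotheses (mA1 : measurable A1) (mA2 : measurable A2).
Hypotheses (iZ1 : m1.-integrable setT (EFin \o Z1)) (iZ2 : m2.-integrable setT (EFin \o Z2)).

Let excess_small d (T : measurableType d) (m : {finite_measure set T -> \bar R}) A Z :
  measurable A -> m.-integrable setT (EFin \o Z) -> forall e, 0 < e ->
  exists k0, forall k, k0 <= k ->
    0 <= pot m A Z k - (k * fine (m A) - \int[m]_(w in A) Z w) <= e.
Proof.
move=> mA iZ e e0.
have mZ : measurable_fun setT Z by apply/measurable_EFinP; exact: measurable_int iZ.
have mN : measurable_fun setT (fun w => - Z w) by exact: measurableT_comp.
have iN : hinge_integrable m (fun w => - Z w).
  by apply: integrable_hinge; exact: (integrableN iZ).
have [k0 hk] := pot_small mN iN mA e0.
exists (- k0) => k kk; rewrite (pot_reflect k mA iZ) addrAC subrr add0r.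
by rewrite pot_ge0/= hk// lerNl.
Qed.

(** Potentials have the asymptote mass * k - mean at +oo. *)
Lemma pot_asymp :
  (forall e, 0 < e -> exists k0, forall k, k0 <= k -> `|pot m1 A1 Z1 k - pot m2 A2 Z2 k| <= e) ->
  fine (m1 A1) = fine (m2 A2) /\ \int[m1]_(w in A1) Z1 w = \int[m2]_(w in A2) Z2 w.
Proof.
move=> h.
have [] := @affine_small (fine (m1 A1) - fine (m2 A2))
    (\int[m1]_(w in A1) Z1 w - \int[m2]_(w in A2) Z2 w); last by lra.
move=> e e0; have e3 : 0 < e / 3 by lra.
have [k0 h0] := h _ e3; have [k1 h1] := excess_small mA1 iZ1 e3.
have [k2 h2] := excess_small mA2 iZ2 e3.
exists (Num.max k0 (Num.max k1 k2)) => k; rewrite !ge_max => /and3P[/h0 a /h1 b /h2 c].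
move: a b c; rewrite !ler_norml => /andP[? ?] /andP[? ?] /andP[? ?].
by apply/andP; split; lra.
Qed.

Lemma pot_asymp_eq : fine (m1 A1) = fine (m2 A2) ->
  \int[m1]_(w in A1) Z1 w = \int[m2]_(w in A2) Z2 w ->
  forall e, 0 < e -> exists k0, forall k, k0 <= k -> `|pot m1 A1 Z1 k - pot m2 A2 Z2 k| <= e.
Proof.
move=> em eb e e0.
have [k1 h1] := excess_small mA1 iZ1 e0.
have [k2 h2] := excess_small mA2 iZ2 e0.
exists (Num.max k1 k2) => k; rewrite !ge_max => /andP[/h1 b /h2 c].
move: b c; rewrite em eb ler_norml => /andP[? ?] /andP[? ?].
by apply/andP; split; lra.
Qed.

End asymptotics.

Section convex_order_facts.
Context {R : realType}.

Lemma cvx_convex_function (g : R -> R) : cvx g -> @convex_function R R^o setT g.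
Proof.
move=> cg t x y _ _.
change (g (t%:num * x + (1 - t%:num) * y) <= t%:num * g x + (1 - t%:num) * g y).
have t0 : 0 <= t%:num by [].
have t1 : t%:num <= 1 by [].
move: (t%:num) t0 t1 => p p0 p1 {t}.
wlog xy : p p0 p1 x y / x <= y => [hw|].
  have [|yx] := leP x y; first exact: hw.
  have := hw (1 - p) ltac:(lra) ltac:(lra) y x (ltW yx).
  have -> : 1 - (1 - p) = p by ring.
  by rewrite addrC [X in _ <= X]addrC.
move: xy; rewrite le_eqVlt => /predU1P[<-|xy].
  by rewrite -!mulrDl addrCA subrr addr0 !mul1r.
have yx0 : 0 < y - x by lra.
rewrite -(ler_pM2l yx0).
have := cg x (p * x + (1 - p) * y) y ltac:(nra) ltac:(nra).
by congr (_ <= _); ring.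
Qed.

Variables (mu nu : probability R R).
Hypotheses (mu_moment : finite_first_moment mu) (nu_moment : finite_first_moment nu).
Hypothesis mu_nu : convex_order mu nu.

(** The convex order enters the argument only through its test functions hinge k,
    here, and y and - y, in the next lemma. *)
Lemma convex_order_pot k : pot mu setT id k <= pot nu setT id k.
Proof.
have /mu_nu h : @convex_function R R^o setT (fun y => hinge k y).
  apply: cvx_convex_function.
  have -> : hinge k = (fun y => Num.max (k + (-1) * y) (0 + 0 * y)).
    by apply/funext => y; rewrite /hinge; congr Num.max; ring.
  by apply: cvx_max; exact: cvx_affine.
apply: fine_le => //; apply: integrable_fin_num => //.
  exact: (integrable_hinge mu_moment).
exact: (integrable_hinge nu_moment).
Qed.

Lemma convex_order_mean : \int[mu]_x x = \int[nu]_x x.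
Proof.
have h1 : @convex_function R R^o setT (fun y => y).
  by apply: cvx_convex_function => a k b ak kb; lra.
have h2 : @convex_function R R^o setT (fun y => - y).
  by apply: cvx_convex_function => a k b ak kb; lra.
have {h1} h1 := mu_nu h1; have {h2} := mu_nu h2.
move=> h2; apply: (congr1 fine); apply/eqP; rewrite eq_le h1/=.
have e (m : probability R R) : finite_first_moment m ->
    (\int[m]_x (- x)%:E = - \int[m]_x x%:E)%E.
  by move=> im; rewrite -integralN//; exact: integrable_add_def.
by move: h2; rewrite !e// leeN2.
Qed.

Lemma convex_order_pot_asymp e : 0 < e ->
  exists k0, forall k, k0 <= k -> `|pot nu setT id k - pot mu setT id k| <= e.
Proof.
have em : fine (nu setT) = fine (mu setT) by rewrite (probability_setT mu) (probability_setT nu).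
exact: (@pot_asymp_eq _ _ _ _ _ nu mu setT setT id id measurableT measurableT
  nu_moment mu_moment em (esym convex_order_mean)).
Qed.

End convex_order_facts.

(** * The potential of the shadow *)

Section shadow.
Context {R : realType}.
Variables (mu nu : probability R R).
Hypotheses (mu_moment : finite_first_moment mu) (nu_moment : finite_first_moment nu).
Hypothesis mu_nu : convex_order mu nu.
Implicit Types A B : set R.

(** For A = ]-oo, x] the greatest convex minorant of the obstacle is the potential
    of what remains of nu once the shadow of the restriction of mu to A has
    been removed: any part of nu that dominates this restriction in convex order
    leaves a remainder whose potential is a convex minorant of the obstacle. *)
Definition obstacle A k := pot nu setT id k - pot mu A id k.
Definition residual A := cvx_hull (obstacle A).

Let mid : measurable_fun setT (@id R). Proof. by []. Qed.
Let imu : hinge_integrable mu id. Proof. exact: integrable_hinge mu_moment. Qed.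
Let inu : hinge_integrable nu id. Proof. exact: integrable_hinge nu_moment. Qed.

(** The convex order between mu and nu provides the convex minorant without which
    the hull would be meaningless. *)
Lemma le_obstacle A k : measurable A -> pot mu (~` A) id k <= obstacle A k.
Proof.
move=> mA; have := convex_order_pot mu_moment nu_moment mu_nu k.
by rewrite (pot_setC imu k mA) /obstacle; lra.
Qed.

Lemma obstacle_minorant A : measurable A -> minorants (obstacle A) !=set0.
Proof.
move=> mA; exists (pot mu (~` A) id); split; last by move=> k; exact: le_obstacle.
by apply: pot_cvx => //; exact: measurableC.
Qed.

Lemma obstacle_lip A : measurable A ->
  lip (fine (nu setT) + fine (mu setT)) (obstacle A).
Proof. by move=> mA; apply: lipB; exact: pot_lip. Qed.

Lemma residual_cvx A : measurable A -> cvx (residual A).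
Proof. by move=> mA; apply: cvx_hull_cvx; exact: obstacle_minorant. Qed.

Lemma residual_lip A : measurable A -> lip (fine (nu setT) + fine (mu setT)) (residual A).
Proof. by move=> mA; apply: cvx_hull_lip; [exact: obstacle_minorant|exact: obstacle_lip]. Qed.

Lemma residual_le A k : measurable A -> residual A k <= obstacle A k.
Proof. by move=> mA; apply: cvx_hull_le; exact: obstacle_minorant. Qed.

Lemma le_residual A k : measurable A -> pot mu (~` A) id k <= residual A k.
Proof.
move=> mA; apply: le_cvx_hull; last by move=> z; exact: le_obstacle.
by apply: pot_cvx => //; exact: measurableC.
Qed.

Lemma residual0 : residual set0 = pot nu setT id.
Proof.
rewrite /residual; have -> : obstacle set0 = pot nu setT id.
  by apply/funext => k; rewrite /obstacle {2}/pot Rintegral_set0 subr0.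
by apply: cvx_hull_id; exact: pot_cvx.
Qed.

(** Enlarging A from A to B subtracts the convex potential of mu on B minus A;
    taking hulls in two steps turns this into a single instance of the
    convexity of f minus the hull of f - g, with f the residual of A. *)
Lemma residual_sub_cvx A B : measurable A -> measurable B -> A `<=` B ->
  cvx (fun k => residual A k - residual B k).
Proof.
move=> mA mB AB.
have mBA : measurable (B `\` A) by exact: measurableD.
have cg : cvx (pot mu (B `\` A) id) by exact: pot_cvx.
have oB : obstacle B = (fun k => obstacle A k - pot mu (B `\` A) id k).
  apply/funext => k; rewrite /obstacle -{1}(setDUK AB) potU//; first by lra.
  by rewrite setDE setICA setICr setI0.
have mo : minorants (fun k => obstacle A k - pot mu (B `\` A) id k) !=set0.
  by rewrite -oB; exact: obstacle_minorant.
have e : residual B = cvx_hull (fun k => residual A k - pot mu (B `\` A) id k).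
  by rewrite /residual cvx_hull_sub_hull// oB.
have := @sub_cvx_hull_cvx _ (fine (nu setT) + fine (mu setT)) (residual A) (pot mu (B `\` A) id)
  (residual_cvx mA) cg (residual_lip mA).
rewrite -e; apply.
  move=> s t st; apply: le_trans (pot_lip mid imu mBA st) _.
  by rewrite ler_wpM2r ?subr_ge0// lerDr fine_ge0.
exists (pot mu (~` B) id); split; first by apply: pot_cvx => //; exact: measurableC.
move=> k; have := le_residual k mA.
have -> : ~` A = ~` B `|` B `\` A.
  apply/seteqP; split => [y nA|y [nB /AB//|[]//]].
  by have [By|nB] := pselect (B y); [right|left].
rewrite potU//; [by lra|exact: measurableC|].
by apply/seteqP; split => // y [nB []].
Qed.

(** The residual of the empty set is the potential of nu itself, so that this is
    the case A = set0 of the monotonicity of residuals. *)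
Lemma shadow_exists A : measurable A -> exists th : {finite_measure set R -> \bar R},
  hinge_integrable th id /\ forall k, pot th setT id k = pot nu setT id k - residual A k.
Proof.
move=> mA.
have c := residual_sub_cvx measurable0 mA (@sub0set _ A).
have l := lipB (residual_lip measurable0) (residual_lip mA).
have [|th [ith eth]] := pot_surjective c l.
  move=> e e0; have [k0 hk] := pot_small mid inu measurableT e0.
  exists k0 => k /hk kk; rewrite residual0.
  have := le_residual k mA; have := residual_le k mA; rewrite /obstacle.
  have := pot_ge0 mu id A k; have := pot_ge0 mu id (~` A) k => ? ? ? ?.
  by rewrite ler_norml; apply/andP; split; lra.
by exists th; split => // k; rewrite eth residual0.
Qed.

Lemma shadow_le_nu A (th : {finite_measure set R -> \bar R}) : measurable A ->
  hinge_integrable th id -> (forall k, pot th setT id k = pot nu setT id k - residual A k) ->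
  exists r : {finite_measure set R -> \bar R},
    forall B, measurable B -> nu B = (th B + r B)%E.
Proof.
move=> mA ith eth; apply: pot_cvx_sub_le => //.
have -> : (fun k => pot nu setT id k - pot th setT id k) = residual A.
  by apply/funext => k; rewrite eth; lra.
exact: residual_cvx.
Qed.

(** The potential of the shadow lies between that of mu on A and the same
    increased by the difference of the potentials of nu and mu, which vanishes
    at +oo because mu and nu have the same mass and the same mean. *)
Lemma shadow_mass A (th : {finite_measure set R -> \bar R}) : measurable A ->
  hinge_integrable th id -> (forall k, pot th setT id k = pot nu setT id k - residual A k) ->
  fine (th setT) = fine (mu A).
Proof.
move=> mA ith eth; have [r er] := shadow_le_nu mA ith eth.
have inth : th.-integrable setT (EFin \o id) by exact: integrable_le_measure er nu_moment.
apply: (proj1 (@pot_asymp _ _ _ _ _ th mu setT A id id measurableT mA inth mu_moment _)) => e e0.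
have [k0 hk] := convex_order_pot_asymp mu_moment nu_moment mu_nu e0.
exists k0 => k /hk; rewrite eth !ler_norml => /andP[? ?].
have := le_residual k mA; have := residual_le k mA; rewrite /obstacle.
have := pot_setC imu k mA => ? ? ?.
by apply/andP; split; lra.
Qed.

End shadow.

(** * Monotone families of densities *)

(** On every set the integrals of f and of the minimum of f and g agree, so these
    functions agree almost everywhere. *)
Lemma ae_le_integral d (T : measurableType d) (R : realType)
    (m : {measure set T -> \bar R}) (f g : T -> \bar R) :
  m.-integrable setT f -> m.-integrable setT g ->
  (forall x, 0 <= f x)%E -> (forall x, 0 <= g x)%E ->
  (forall B, measurable B -> \int[m]_(x in B) f x <= \int[m]_(x in B) g x)%E ->
  {ae m, forall x, (f x <= g x)%E}.
Proof.
move=> fi gi f0 g0 fg.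
have mf := measurable_int _ fi; have mg := measurable_int _ gi.
have mm : measurable_fun setT (fun x => mine (f x) (g x)) by exact: measurable_mine.
have m0 x : (0 <= mine (f x) (g x))%E by rewrite le_min f0 g0.
have mD : measurable [set x | (f x <= g x)%E].
  by rewrite -[X in measurable X]setTI; exact: measurable_lee.
have : ae_eq m setT f (fun x => mine (f x) (g x)).
  apply: integral_ae_eq => // E _ mE; apply/eqP; rewrite eq_le; apply/andP; split; last first.
    apply: ge0_le_integral => //; [exact: measurable_funS mm|exact: measurable_funS mf|].
    by move=> x _; rewrite ge_min lexx.
  rewrite -(setUIDK E [set x | (f x <= g x)%E]).
  have m1 : measurable (E `&` [set x | (f x <= g x)%E]) by exact: measurableI.
  have m2 : measurable (E `\` [set x | (f x <= g x)%E]) by exact: measurableD.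
  have dj : [disjoint E `&` [set x | (f x <= g x)%E] & E `\` [set x | (f x <= g x)%E]].
    by rewrite disj_set2E; apply/eqP/seteqP; split => // x [[_ ?] []].
  rewrite !ge0_integral_setU//; try by apply: measurable_funS mf || apply: measurable_funS mm.
  apply: leeD.
    rewrite le_eqVlt; apply/orP; left; apply/eqP; apply: eq_integral => x.
    by rewrite inE => -[_ /= /min_idPl ->].
  apply: le_trans (fg _ m2) _.
  rewrite le_eqVlt; apply/orP; left; apply/eqP; apply: eq_integral => x.
  by rewrite inE => -[_ /= /negP]; rewrite -ltNge => /ltW /min_idPr ->.
apply: filterS => x /(_ Logic.I) ->.
by rewrite ge_min lexx orbT.
Qed.

Lemma ae_forall_countable d (T : measurableType d) (R : realType) (I : countType)
    (m : {measure set T -> \bar R}) (P : I -> T -> Prop) :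
  (forall i, {ae m, forall x, P i x}) -> {ae m, forall x, forall i, P i x}.
Proof.
move=> h.
have : {ae m, forall x, forall n, if unpickle n is Some i then P i x else True}.
  by apply: ae_foralln => n; case: (unpickle n) => [i|]; [exact: h|exact: aeW].
by apply: filterS => x hx i; have := hx (pickle i); rewrite pickleK.
Qed.

Section densities.
Context {R : realType}.
Variables (nu : probability R R) (th : rat -> {finite_measure set R -> \bar R}).
Hypothesis th_nd : forall q r, q <= r -> forall B, measurable B -> (th q B <= th r B)%E.
Hypothesis th_nu : forall q B, measurable B -> (th q B <= nu B)%E.

(** Radon-Nikodym densities, indexed by the rationals so that the countably many
    almost sure inequalities between them hold together off a single null set,
    where the densities are reset to 0. *)
Lemma monotone_densities : exists h : rat -> R -> R,
  [/\ forall q, measurable_fun setT (h q), forall q y, 0 <= h q y <= 1,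
      forall q r, q <= r -> forall y, h q y <= h r y &
      forall q B, measurable B -> th q B = (\int[nu]_(y in B) (h q y)%:E)%E].
Proof.
have dom q : th q `<< nu.
  apply/null_content_dominatesP => B mB B0; apply/eqP; rewrite -measure_le0 -B0.
  exact: th_nu.
have /choice[f hf] : forall q, exists f : R -> \bar R, [/\ forall x, (0 <= f x)%E,
    forall x, f x \is a fin_num, nu.-integrable setT f &
    forall A, measurable A -> th q A = \int[nu]_(x in A) f x]%E.
  by move=> q; apply: radon_nikodym_sigma_finite.
have ae1 : {ae nu, forall y, forall q, (f q y <= 1)%E}.
  apply: ae_forall_countable => q; have [f0 ff fi fE] := hf q.
  apply: (ae_le_integral (g := cst 1%E)) => //.
    exact: (finite_measure_integrable_cst nu 1 measurableT).
  move=> B mB; rewrite -fE// integral_cst// mul1e; exact: th_nu.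
have ae2 : {ae nu, forall y, forall qr : rat * rat, qr.1 <= qr.2 -> (f qr.1 y <= f qr.2 y)%E}.
  apply: ae_forall_countable => -[q r] /=; have [f0 ff fi fE] := hf q.
  have [g0 gf gi gE] := hf r.
  have [qr|_] := leP q r; last exact: aeW.
  have : {ae nu, forall y, (f q y <= f r y)%E}.
    by apply: ae_le_integral => // B mB; rewrite -fE// -gE//; exact: th_nd.
  by apply: filterS => y ? _.
have : {ae nu, forall y, (forall q, (f q y <= 1)%E) /\
    forall qr : rat * rat, qr.1 <= qr.2 -> (f qr.1 y <= f qr.2 y)%E}.
  by apply: filterS2 ae1 ae2.
move=> [N [mN N0 hN]].
have good y : ~ N y -> (forall q, (f q y <= 1)%E) /\
    forall qr : rat * rat, qr.1 <= qr.2 -> (f qr.1 y <= f qr.2 y)%E.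
  by move=> nN; apply: contrapT => bad; apply: nN; exact: hN.
pose h q y := if y \in N then 0 else fine (f q y).
exists h; split.
- move=> q; have [f0 ff fi fE] := hf q; apply: measurable_fun_if => //.
    by apply: (measurable_fun_bool true); rewrite /= setTI preimage_mem_true.
  by apply: measurable_funTS; apply: measurableT_comp => //; exact: measurable_int fi.
- move=> q y; have [f0 ff fi fE] := hf q; rewrite /h; case: ifPn => [_|/negP yN].
    by rewrite lexx ler01.
  have [|b1 _] := good y; first by move=> Ny; apply: yN; rewrite inE.
  by rewrite fine_ge0//= -lee_fin fineK.
- move=> q r qr y; rewrite /h; case: ifPn => // /negP yN.
  have [|_ b2] := good y; first by move=> Ny; apply: yN; rewrite inE.
  have [_ ff _ _] := hf q; have [_ gf _ _] := hf r.
  by apply: fine_le => //; exact: (b2 (q, r)).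
- move=> q B mB; have [f0 ff fi fE] := hf q; rewrite fE//.
  apply: ge0_ae_eq_integral => //.
  + by apply: measurable_funTS; exact: measurable_int fi.
  + apply/measurable_EFinP; apply: measurable_funTS; apply: measurable_fun_if => //.
      by apply: (measurable_fun_bool true); rewrite /= setTI preimage_mem_true.
    by apply: measurable_funTS; apply: measurableT_comp => //; exact: measurable_int fi.
  + by move=> y _; rewrite lee_fin /h; case: ifP => // _; exact: fine_ge0.
  + exists N; split => // y /=; apply: contra_notP => Ny _.
    by rewrite /h memNset// fineK.
Qed.

End densities.

(** * Gluing an increasing family of measures into a coupling *)

Section rays_small.
Context {R : realType} (mu : probability R R).

Lemma cvg_null_seq_small (F : (set R)^nat) e : (forall n, measurable (F n)) ->
  nonincreasing_seq F -> mu (\bigcap_n F n) = 0%E -> 0 < e ->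
  exists n, fine (mu (F n)) <= e.
Proof.
move=> mF ndF F0 e0.
have h : mu \o F @ \oo --> mu (\bigcap_n F n).
  apply: nonincreasing_cvg_mu => //; last exact: bigcap_measurable.
  by rewrite -ge0_fin_numE// fin_num_measure.
rewrite F0 in h.
have {h}/cvgr_le h : (fine (mu (F n))) @[n --> \oo] --> (0 : R).
  by have := fine_cvg h; apply.
have /h [n _ hn] : 0 < e by [].
by exists n; apply: hn => /=.
Qed.

Lemma ray_small_left e : 0 < e -> exists x : R, fine (mu `]-oo, x]%classic) <= e.
Proof.
move=> e0.
pose F n := `]-oo, (- n%:R : R)]%classic.
have [|||n hn] := @cvg_null_seq_small F e _ _ _ e0; rewrite /F.
- by move=> n; exact: measurable_itv.
- move=> p q pq; apply/subsetPset; apply: subset_itvl.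
  by rewrite bnd_simp lerN2 ler_nat.
- rewrite [X in mu X](_ : _ = set0) ?measure0//; apply/seteqP; split => // x hx.
  have := hx (Num.bound `|x|) Logic.I; rewrite /= in_itv/=.
  have := archi_boundP (normr_ge0 x); have := ler_norm (- x); rewrite normrN.
  by move=> ? ? ?; lra.
- by exists (- n%:R); exact: hn.
Qed.

Lemma ray_small_right e : 0 < e -> exists x : R, 1 - fine (mu `]-oo, x]%classic) <= e.
Proof.
move=> e0.
pose F n := `](n%:R : R), +oo[%classic.
have [|||n hn] := @cvg_null_seq_small F e _ _ _ e0; rewrite /F.
- by move=> n; exact: measurable_itv.
- move=> p q pq; apply/subsetPset => x /=; rewrite !in_itv/= !andbT.
  by apply: le_lt_trans; rewrite ler_nat.
- rewrite [X in mu X](_ : _ = set0) ?measure0//; apply/seteqP; split => // x hx.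
  have := hx (Num.bound `|x|) Logic.I; rewrite /= in_itv/= andbT.
  have := archi_boundP (normr_ge0 x); have := ler_norm x.
  by move=> ? ? ?; lra.
- exists n%:R; apply: le_trans hn; rewrite /F.
  have -> : `]n%:R, +oo[%classic = ~` `]-oo, (n%:R : R)]%classic by rewrite setCitvl.
  by rewrite probability_setC// fineB ?fin_num_measure.
Qed.

Lemma ray_continuous e x : atomless mu -> 0 < e -> exists d : R, 0 < d /\
  fine (mu `]-oo, x + d]%classic) - fine (mu `]-oo, x - d]%classic) <= e.
Proof.
move=> mu0 e0.
pose F n := `]x - n.+1%:R^-1, x + n.+1%:R^-1]%classic.
have [|||n hn] := @cvg_null_seq_small F e _ _ _ e0; rewrite /F.
- by move=> n; exact: measurable_itv.
- move=> p q pq; apply/subsetPset; apply: subset_itv; rewrite bnd_simp.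
    by rewrite lerD2l lerN2 lef_pV2 ?posrE// ler_nat.
  by rewrite lerD2l lef_pV2 ?posrE// ler_nat.
- rewrite [X in mu X](_ : _ = [set x]) ?mu0//; apply/seteqP; split => [y hy|_ ->]; last first.
    move=> n _ /=; rewrite in_itv/= ltrBlDr ltrDl lerDl.
    by apply/andP; split; [|apply: ltW].
  have hyn n : `|y - x| <= n.+1%:R^-1.
    by have := hy n Logic.I; rewrite /= in_itv/= ler_norml; move: (n.+1%:R^-1) => c /andP[? ?]; apply/andP; split; lra.
  apply/eqP; rewrite -subr_eq0 -normr_le0 leNgt; apply/negP => h0.
  have := hyn (Num.bound (`|y - x|^-1)); apply/negP; rewrite -ltNge.
  rewrite invf_plt ?posrE//; apply: lt_trans (archi_boundP _) _; first by rewrite invr_ge0.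
  by rewrite ltr_nat.
exists n.+1%:R^-1; split; first by rewrite invr_gt0.
apply: le_trans hn; rewrite /F.
have -> : `]x - n.+1%:R^-1, x + n.+1%:R^-1]%classic =
    `]-oo, x + n.+1%:R^-1] `\` `]-oo, x - n.+1%:R^-1].
  by rewrite -[RHS]setCK setCD setCitvl setUC -[LHS]setCK setCitv.
have sub : `]-oo, x - n.+1%:R^-1]%classic `<=` `]-oo, x + n.+1%:R^-1].
  apply: subset_itvl; rewrite bnd_simp lerD2l.
  by apply: (@le_trans _ _ 0); rewrite ?oppr_le0 invr_ge0.
by rewrite measureD ?setIidr// ?fineB ?fin_num_measure// -ge0_fin_numE// fin_num_measure.
Qed.

End rays_small.

Lemma measure_eq_off_null d (T : measurableType d) (R : realType)
    (m : {measure set T -> \bar R}) (A B N : set T) :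
  measurable A -> measurable B -> measurable N -> m N = 0%E ->
  (forall x, ~ N x -> (A x <-> B x)) -> m A = m B.
Proof.
move=> mA mB mN N0 AB.
have aux C D : measurable C -> measurable D -> (forall x, ~ N x -> C x -> D x) -> (m C <= m D)%E.
  move=> mC mD CD; apply: (@le_trans _ _ (m (D `|` N))).
    apply: le_measure; rewrite ?inE//; first exact: measurableU.
    by move=> x Cx; have [Nx|Nx] := pselect (N x); [right|left; exact: CD].
  by rewrite measureU0.
by apply/eqP; rewrite eq_le !aux// => x /AB [].
Qed.

Section coupling.
Context {R : realType}.
Variables (mu nu : probability R R) (th : R -> {finite_measure set R -> \bar R}).
Hypothesis mu_atomless : atomless mu.
Hypothesis th_nd : forall x y, x <= y -> forall B, measurable B -> (th x B <= th y B)%E.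
Hypothesis th_nu : forall x B, measurable B -> (th x B <= nu B)%E.
Hypothesis th_mass : forall x, fine (th x setT) = fine (mu `]-oo, x]%classic).

(** Given Y = y, the densities h q y form the conditional distribution function
    of X at the rationals, so X is obtained as its quantile function at an
    independent uniform variable. The atomlessness of mu makes x |-> th x B
    continuous, which extends the identity from rational levels to all x. *)
Lemma coupling_of_increasing_family : exists P : probability (R * R)%type R,
  (forall x B, measurable B -> P (`]-oo, x]%classic `*` B) = th x B) /\
  (forall B, measurable B -> P (setT `*` B) = nu B).
Proof.
have [||h [mh h01 h_nd hE]] := @monotone_densities _ nu (fun q => th (ratr q)).
- by move=> q r qr; apply: th_nd; rewrite ler_rat.
- by move=> q; apply: th_nu.
pose idR : measurableTypeR R -> R := idfun.
have mid : measurable_fun setT idR.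
  exact: (@measurable_id _ (measurableTypeR R) setT).
pose U : probability R R := distribution (uniform_prob (@ltr01 R)) (mfun_Sub (mem_set mid)).
pose W : probability (R * R)%type R := (nu \x U)%E.
have UE c : 0 <= c <= 1 -> U `]-oo, c]%classic = c%:E.
  move=> /andP[c0 c1]; rewrite /U /= /pushforward /= preimage_id /uniform_prob integral_uniform_pdf.
  have -> : `]-oo, c] `&` `[0, 1] = `[0, c]%classic.
    apply/seteqP; split => y /=; rewrite !in_itv/=; first by move=> [-> /andP[-> _]].
    by move=> /andP[-> yc]; rewrite yc (le_trans yc c1).
  rewrite (eq_integral (cst 1%E)); last first.
    move=> y; rewrite inE/= in_itv/= => /andP[y0 yc].
    by rewrite /uniform_pdf y0 (le_trans yc c1)/= subr0 invr1.
  by rewrite integral_cst//= mul1e lebesgue_measure_itv/= lte_fin; case: ltP => // c00;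
    [rewrite sube0|congr (_%:E); apply/eqP; rewrite eq_le c0 c00].
pose S q : set (R * R) := [set w | w.2 <= h q w.1].
have m2 : measurable_fun [set: R * R] (fun w : R * R => w.2) by exact: measurable_snd.
have m1h q : measurable_fun [set: R * R] (fun w : R * R => h q w.1).
  by apply: measurableT_comp => //; exact: measurable_fst.
have mS q : measurable (S q).
  rewrite -[X in measurable X]setTI; exact: (measurable_fun_ler m2 (m1h q) measurableT).
have mT (B : set R) : measurable B -> measurable (B `*` [set: R]) by move=> mB; exact: measurableX.
have WS q (B : set R) : measurable B -> W (S q `&` (B `*` [set: R])) = th (ratr q) B.
  move=> mB; rewrite hE// /W /= /product_measure1/= [RHS]integral_mkcond/=.
  apply: eq_integral => y _; rewrite restrict_EFin/= patchE.
  case: ifPn => yB.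
    rewrite -UE//; congr (U _); apply/seteqP; split => t; rewrite /xsection/= inE/=.
      by move=> [].
    by rewrite in_itv/= => ?; split => //; split => //; exact: set_mem.
  rewrite [X in U X](_ : _ = set0) ?measure0//; apply/seteqP; split => // t.
  by rewrite /xsection/= inE/= => -[_ [/mem_set]]; rewrite (negPf yB).
have WB (B : set R) : measurable B -> W (B `*` [set: R]) = nu B.
  move=> mB; have -> : nu B = (nu B * U setT)%E by rewrite probability_setT mule1.
  exact: product_measure1E.
clearbody W.
(* phi (y, t) is the infimum of the rationals q with t <= h q y; it is infinite on a
   null set only *)
pose u n (w : R * R) := if unpickle n is Some q then
  if w.2 <= h q w.1 then (ratr q)%:E else +oo%E else (+oo%E : \bar R).
pose phi w := einfs (u ^~ w) 0%N.
have mphi : measurable_fun setT phi.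
  apply: measurable_fun_einfs => n; rewrite /u; case: (unpickle n) => // q.
  by apply: measurable_fun_ifT => //; exact: measurable_fun_ler.
have phi_le q w : S q w -> (phi w <= (ratr q)%:E)%E.
  move=> Sw; apply: ereal_inf_lbound; exists (pickle q) => //.
  by rewrite /u pickleK; move: Sw; rewrite /S /= => ->.
have phi_lt x w : (phi w < x%:E)%E -> exists2 q, ratr q < x & S q w.
  move=> /ereal_inf_lt [_ [n _ <-]]; rewrite /u; case: (unpickle n) => // q.
  by case: ifPn => // Sw; rewrite lte_fin => qx; exists q.
pose E x : set (R * R) := [set w | (phi w <= x%:E)%E].
have mE x : measurable (E x).
  by rewrite -[X in measurable X]setTI; apply: emeasurable_fun_infty_c.
(* the increments of th are largest on the whole line, where they are increments of
   the continuous distribution function of mu *)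
have gap x y B : x <= y -> measurable B ->
    fine (th y B) - fine (th x B) <= fine (th y setT) - fine (th x setT).
  move=> xy mB; have mC := measurableC mB.
  rewrite -(setUv B) !measureU ?setICr// !fineD ?fin_num_measure//.
  have : fine (th x (~` B)) <= fine (th y (~` B)).
    by apply: fine_le; rewrite ?fin_num_measure//; exact: th_nd.
  by lra.
have WE x (B : set R) : measurable B -> W (E x `&` (B `*` [set: R])) = th x B.
  move=> mB.
  have mEB : measurable (E x `&` (B `*` [set: R])) by apply: measurableI => //; exact: mT.
  have mSB q : measurable (S q `&` (B `*` [set: R])) by apply: measurableI => //; exact: mT.
  rewrite -[LHS]fineK ?fin_num_measure// -[RHS]fineK ?fin_num_measure//; congr (_%:E).
  apply/eqP; rewrite -subr_eq0 -normr_le0; apply/ler_addgt0Pl => e e0; rewrite addr0.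
  have [d [d0 hd]] := ray_continuous x mu_atomless e0.
  have /rat_in_itvoo[q] : x - d < x by lra.
  have /rat_in_itvoo[r] : x < x + d by lra.
  rewrite !in_itv/= => /andP[xr rd] /andP[dq qx].
  have l1 : fine (th (ratr q) B) <= fine (W (E x `&` (B `*` [set: R]))).
    rewrite -(WS q B mB); apply: fine_measure_le; [exact: mSB|exact: mEB|].
    move=> w [Sw Bw]; split => //.
    by apply: le_trans (phi_le _ _ Sw) _; rewrite lee_fin ltW.
  have l2 : fine (W (E x `&` (B `*` [set: R]))) <= fine (th (ratr r) B).
    rewrite -(WS r B mB); apply: fine_measure_le; [exact: mEB|exact: mSB|].
    move=> w [Ew Bw]; split => //.
    have [|p pr Sp] := phi_lt (ratr r) w; first by apply: le_lt_trans Ew _; rewrite lte_fin.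
    by apply: le_trans Sp _; apply: h_nd; move: pr; rewrite ltr_rat => /ltW.
  have th_le s t : s <= t -> fine (th s B) <= fine (th t B).
    by move=> st; apply: fine_le; rewrite ?fin_num_measure//; exact: th_nd.
  have l3 := th_le _ _ (ltW qx); have l4 := th_le _ _ (ltW xr).
  have qr : ratr q <= ratr r :> R by lra.
  have := gap _ _ _ qr mB; rewrite !th_mass => l5.
  have l6 : fine (mu `]-oo, ratr r]%classic) <= fine (mu `]-oo, x + d]%classic).
    by apply: fine_measure_le => //; apply: subset_itvl; rewrite bnd_simp ltW.
  have l7 : fine (mu `]-oo, x - d]%classic) <= fine (mu `]-oo, ratr q]%classic).
    by apply: fine_measure_le => //; apply: subset_itvl; rewrite bnd_simp ltW.
  by rewrite ler_norml; apply/andP; split; lra.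
have WEm x : fine (W (E x)) = fine (mu `]-oo, x]%classic).
  by rewrite -th_mass -(WE x setT measurableT) setXTT setIT.
have mNy : measurable [set w | phi w = -oo%E].
  by rewrite -[X in measurable X]setTI; exact: (mphi measurableT _ (emeasurable_set1 _)).
have mPy : measurable [set w | phi w = +oo%E].
  by rewrite -[X in measurable X]setTI; exact: (mphi measurableT _ (emeasurable_set1 _)).
have null0 A : measurable A -> (forall e, 0 < e -> fine (W A) <= e) -> W A = 0%E.
  move=> mA hA; apply/eqP; rewrite -fine_eq0 ?fin_num_measure// eq_le fine_ge0// andbT.
  by apply/ler_addgt0Pl => e e0; rewrite addr0; exact: hA.
have Ny0 : W [set w | phi w = -oo%E] = 0%E.
  apply: null0 => // e e0; have [x hx] := ray_small_left mu e0.
  apply: le_trans hx; rewrite -WEm; apply: fine_measure_le => // w /= pw.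
  by rewrite /E /= pw leNye.
have Py0 : W [set w | phi w = +oo%E] = 0%E.
  apply: null0 => // e e0; have [x hx] := ray_small_right mu e0.
  apply: le_trans hx; rewrite -WEm.
  have -> : 1 - fine (W (E x)) = fine (W (~` E x)).
    by rewrite probability_setC// fineB ?fin_num_measure.
  apply: fine_measure_le => //; first exact: measurableC.
  by move=> w /= pw; rewrite /E /= pw.
pose Z w := (fine (phi w), w.1).
have mZ : measurable_fun setT Z.
  apply: measurable_fun_pair; last exact: measurable_fst.
  by apply: measurableT_comp.
exists (distribution W (mfun_Sub (mem_set mZ))); split => [x B mB|B mB]; last first.
  by rewrite -WB//; congr (W _); apply/seteqP; split => w [].
rewrite -(WE x B mB).
have mRB : measurable (`]-oo, x]%classic `*` B) by exact: measurableX.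
have mA : measurable (Z @^-1` (`]-oo, x]%classic `*` B)).
  by rewrite -[X in measurable X]setTI; exact: mZ.
have mN := measurableU _ _ mNy mPy.
have N0 : W ([set w | phi w = -oo%E] `|` [set w | phi w = +oo%E]) = 0%E.
  exact: etrans (measureU0 mNy mPy Py0) Ny0.
change (W (Z @^-1` (`]-oo, x]%classic `*` B)) = W (E x `&` (B `*` [set: R]))).
have := @measure_eq_off_null _ _ _ W _ _ _ mA (measurableI _ _ (mE x) (mT B mB)) mN N0.
apply.
move=> w; rewrite /Z /E /=; case: (phi w) => [a|nN|nN].
- move=> _; rewrite /= in_itv/= lee_fin; split; first by move=> [].
  by move=> [? []].
- by exfalso; apply: nN; right.
- by exfalso; apply: nN; left.
Qed.

End coupling.

(** * Integrals and image measures *)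

Lemma ge0_integral_law d d' (T : measurableType d) (T' : measurableType d') (R : realType)
    (m : {finite_measure set T -> \bar R}) (A : set T) (Z : T -> T')
    (mA : measurable A) (mZ : measurable_fun setT Z) (f : T' -> \bar R) :
  measurable_fun setT f -> (forall y, 0 <= f y)%E ->
  (\int[law m mA mZ]_y f y = \int[m]_(w in A) f (Z w))%E.
Proof.
move=> mf f0.
have mfZ : measurable_fun setT (f \o Z) by exact: measurableT_comp.
transitivity (\int[pushforward (mrestr m mA) Z]_y f y)%E.
  by apply: eq_measure_integral => B mB _; exact: (congr1 m (setIC _ _)).
rewrite ge0_integral_pushforward// preimage_setT -(setUv A) ge0_integral_setU//=; last 3 first.
- exact: measurableC.
- exact: measurable_funTS.
- by rewrite disj_set2E setICr.
rewrite [X in (_ + X)%E](_ : _ = 0%E) ?adde0; last first.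
  apply: null_set_integral; [exact: measurableC|exact: measurable_funTS|].
  exact: etrans (congr1 m (setICl A)) (measure0 m).
apply: eq_measure_integral => C mC CA; have e : C `&` A = C by rewrite setIidl.
exact: (congr1 m e).
Qed.

Section eq_law.
Context d1 d2 (T1 : measurableType d1) (T2 : measurableType d2) (R : realType).
Variables (m1 : {finite_measure set T1 -> \bar R}) (m2 : {finite_measure set T2 -> \bar R}).
Variables (A1 : set T1) (A2 : set T2) (Z1 : T1 -> R) (Z2 : T2 -> R).
Hypotheses (mA1 : measurable A1) (mA2 : measurable A2).
Hypotheses (mZ1 : measurable_fun setT Z1) (mZ2 : measurable_fun setT Z2).
Hypothesis eq_law : forall B : set R, measurable B -> m1 (A1 `&` Z1 @^-1` B) = m2 (A2 `&` Z2 @^-1` B).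

Lemma ge0_integral_eq_law (f : R -> \bar R) :
  measurable_fun setT f -> (forall y, 0 <= f y)%E ->
  (\int[m1]_(w in A1) f (Z1 w) = \int[m2]_(w in A2) f (Z2 w))%E.
Proof.
move=> mf f0; rewrite -(ge0_integral_law m1 mA1 mZ1)// -(ge0_integral_law m2 mA2 mZ2)//.
by apply: eq_measure_integral => B mB _; exact: eq_law.
Qed.

Lemma pot_eq_law : pot m1 A1 Z1 = pot m2 A2 Z2.
Proof.
apply/funext => k; apply: (congr1 fine).
apply: (@ge0_integral_eq_law (fun y => (hinge k y)%:E)).
  by apply/measurable_EFinP; exact: measurable_hinge.
by move=> y; rewrite lee_fin hinge_ge0.
Qed.

Lemma integrable_eq_law :
  m2.-integrable A2 (EFin \o Z2) -> m1.-integrable A1 (EFin \o Z1).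
Proof.
move=> /integrableP[_ h]; apply/integrableP; split.
  by apply/measurable_EFinP; exact: measurable_funTS.
rewrite (ge0_integral_eq_law (f := fun y => `|y%:E|%E))//.
by apply: measurableT_comp => //; exact/measurable_EFinP.
Qed.

End eq_law.

Section weighted.
Context d d' (T : measurableType d) (T' : measurableType d') (R : realType).
Variables (P : {measure set T -> \bar R}) (X : T -> T') (f : T -> \bar R).

(** The image under X of the measure with density f with respect to P. *)
Definition weighted of measurable_fun setT X & P.-integrable setT f & (forall w, 0 <= f w)%E :=
  fun B : set T' => (\int[P]_(w in X @^-1` B) f w)%E.

Hypotheses (mX : measurable_fun setT X) (fi : P.-integrable setT f).
Hypothesis f0 : (forall w, 0 <= f w)%E.

Let weighted0 : weighted mX fi f0 set0 = 0%E.
Proof. by rewrite /weighted preimage_set0 integral_set0. Qed.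

Let weighted_ge0 B : (0 <= weighted mX fi f0 B)%E.
Proof. by rewrite /weighted integral_ge0. Qed.

Let mXB B : measurable B -> measurable (X @^-1` B).
Proof. by move=> mB; rewrite -[X in measurable X]setTI; exact: mX. Qed.

Let weighted_sigma : semi_sigma_additive (weighted mX fi f0).
Proof.
move=> F mF tF mUF; rewrite /weighted preimage_bigcup ge0_integral_bigcup//=.
- by apply: is_cvg_nneseries => n _ _; exact: integral_ge0.
- by move=> n; exact: mXB.
- by apply: measurable_funTS; exact: measurable_int fi.
- apply/trivIsetP => i j _ _ ij; rewrite -preimage_setI.
  by move/trivIsetP : tF => /(_ _ _ _ _ ij) ->//; rewrite preimage_set0.
Qed.

HB.instance Definition _ := isMeasure.Build _ _ _ (weighted mX fi f0)
  weighted0 weighted_ge0 weighted_sigma.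

Let weighted_fin : fin_num_fun (weighted mX fi f0).
Proof.
move=> B mB; rewrite /weighted; apply: integrable_fin_num; first exact: mXB.
by apply: integrableS fi => //; exact: mXB.
Qed.

HB.instance Definition _ := Measure_isFinite.Build _ _ _ (weighted mX fi f0) weighted_fin.

End weighted.

Section martingale.
Context {R : realType}.
Implicit Types (mu nu : probability R R) (P : probability (R * R)%type R).

Let mfst : measurable_fun [set: R * R] (fst : R * R -> R). Proof. exact: measurable_fst. Qed.
Let msnd : measurable_fun [set: R * R] (snd : R * R -> R). Proof. exact: measurable_snd. Qed.

Lemma measurable_fst_preimage (B : set R) : measurable B -> measurable ((fst : R * R -> R) @^-1` B).
Proof. by move=> mB; rewrite -[X in measurable X]setTI; exact: mfst. Qed.

Lemma measurable_snd_preimage (B : set R) : measurable B -> measurable ((snd : R * R -> R) @^-1` B).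
Proof. by move=> mB; rewrite -[X in measurable X]setTI; exact: msnd. Qed.

(** Adding the integrable function |f| + |g| to both sides makes the integrands
    nonnegative, and the two sides finite measures in B. *)
Lemma Rintegral_rays_eq P (f g : R * R -> R) :
  P.-integrable setT (EFin \o f) -> P.-integrable setT (EFin \o g) ->
  (forall x : R, \int[P]_(w in fst @^-1` `]-oo, x]) f w = \int[P]_(w in fst @^-1` `]-oo, x]) g w) ->
  forall B : set R, measurable B -> \int[P]_(w in fst @^-1` B) f w = \int[P]_(w in fst @^-1` B) g w.
Proof.
move=> fi gi h.
have mf : measurable_fun setT f by apply/measurable_EFinP; exact: measurable_int fi.
have mg : measurable_fun setT g by apply/measurable_EFinP; exact: measurable_int gi.
have ai : P.-integrable setT (EFin \o (fun w => `|f w| + `|g w|)).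
  exact: (integrableD measurableT (integrable_norm fi) (integrable_norm gi)).
have fai : P.-integrable setT (EFin \o (fun w => f w + (`|f w| + `|g w|))).
  exact: (integrableD measurableT fi ai).
have gai : P.-integrable setT (EFin \o (fun w => g w + (`|f w| + `|g w|))).
  exact: (integrableD measurableT gi ai).
have f0 w : (0 <= (EFin \o (fun w => (f w + (`|f w| + `|g w|))%R)) w)%E.
  by rewrite /= lee_fin; have := ler_norm (- f w); have := normr_ge0 (g w); rewrite normrN; lra.
have g0 w : (0 <= (EFin \o (fun w => (g w + (`|f w| + `|g w|))%R)) w)%E.
  by rewrite /= lee_fin; have := ler_norm (- g w); have := normr_ge0 (f w); rewrite normrN; lra.
have S h' B : P.-integrable setT (EFin \o h') -> measurable B ->
    P.-integrable (fst @^-1` B) (EFin \o h').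
  by move=> ih mB; apply: integrableS ih => //; exact: measurable_fst_preimage.
have E h' B : P.-integrable setT (EFin \o h') -> measurable B ->
    \int[P]_(w in fst @^-1` B) (h' w + (`|f w| + `|g w|)) =
    \int[P]_(w in fst @^-1` B) h' w + \int[P]_(w in fst @^-1` B) (`|f w| + `|g w|).
  by move=> ih mB; rewrite RintegralD//; [exact: measurable_fst_preimage|exact: S|exact: S].
move=> B mB.
have := @measure_eq_rays _ (weighted mfst fai f0) (weighted mfst gai g0) _ B mB.
have W s : fine (weighted mfst fai f0 `]-oo, s]%classic) =
    fine (weighted mfst gai g0 `]-oo, s]%classic).
  have e1 := E f `]-oo, s]%classic fi (measurable_itv _).
  have e2 := E g `]-oo, s]%classic gi (measurable_itv _).
  by rewrite h in e1; exact: (etrans e1 (esym e2)).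
move=> /(_ W) /(congr1 fine) e.
by have := etrans (esym (E f B fi mB)) (etrans e (E g B gi mB)) => /addIr.
Qed.

End martingale.

(** * Martingale couplings and crossings of a level *)

Section couplings.
Context {R : realType}.
Variables (mu nu : probability R R).
Hypotheses (mu_moment : finite_first_moment mu) (nu_moment : finite_first_moment nu).
Implicit Types P : probability (R * R)%type R.

Let mfst : measurable_fun [set: R * R] (fst : R * R -> R). Proof. exact: measurable_fst. Qed.
Let msnd : measurable_fun [set: R * R] (snd : R * R -> R). Proof. exact: measurable_snd. Qed.

Lemma fst_integrable P : (forall B : set R, measurable B -> P (fst @^-1` B) = mu B) ->
  P.-integrable setT (EFin \o (fst : R * R -> R)).
Proof.
move=> h.
apply: (@integrable_eq_law _ _ _ _ _ P mu setT setT fst id) => //.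
by move=> B mB; rewrite !setTI; exact: h.
Qed.

Lemma snd_integrable P : (forall B : set R, measurable B -> P (snd @^-1` B) = nu B) ->
  P.-integrable setT (EFin \o (snd : R * R -> R)).
Proof.
move=> h.
apply: (@integrable_eq_law _ _ _ _ _ P nu setT setT snd id) => //.
by move=> B mB; rewrite !setTI; exact: h.
Qed.

(** Since g x = x for mu-almost every x, the conditional expectation can be
    eliminated from the definition. *)
Lemma martingale_couplingP P : martingale_coupling mu nu P <->
  [/\ forall B : set R, measurable B -> P (fst @^-1` B) = mu B,
      forall B : set R, measurable B -> P (snd @^-1` B) = nu B &
      forall B : set R, measurable B ->
        \int[P]_(w in fst @^-1` B) w.2 = \int[P]_(w in fst @^-1` B) w.1].
Proof.
split => [[hX hY [g [iY mg igX hg] ag]]|[hX hY hM]].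
  split => // B mB; apply: (congr1 fine); rewrite (hg B mB).
  have mB' := measurable_fst_preimage mB.
  apply: ae_eq_integral => //.
  - by apply: measurable_funTS; exact: measurable_int igX.
  - by apply/measurable_EFinP; apply: measurable_funTS; exact: measurable_fst.
  have [N [mN N0 hN]] := ag.
  exists (fst @^-1` N); split; first exact: measurable_fst_preimage.
    by rewrite -N0; exact: hX.
  move=> w /= hw; apply: hN => /= gw; apply: hw => _.
  by rewrite /canonX /= gw.
have iX := fst_integrable hX; have iY := snd_integrable hY.
split => //; exists id; last exact: aeW.
split => // B mB.
have mB' := measurable_fst_preimage mB.
have iXB : P.-integrable (fst @^-1` B) (EFin \o (fst : R * R -> R)) by exact: integrableS iX.
have iYB : P.-integrable (fst @^-1` B) (EFin \o (snd : R * R -> R)) by exact: integrableS iY.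
move: (congr1 EFin (hM B mB)); rewrite /Rintegral !fineK//; exact: integrable_fin_num.
Qed.

(** The distance by which a move from x to y oversteps the level k, and 0 if it
    does not cross it. *)
Definition crossing k (w : R * R) := if w.1 < k then Num.max (w.2 - k) 0 else Num.max (k - w.2) 0.

Lemma crossing_ge0 k w : 0 <= crossing k w.
Proof. by rewrite /crossing; case: ifP => _; rewrite le_max lexx orbT. Qed.

Lemma measurable_crossing k : measurable_fun setT (crossing k).
Proof.
apply: measurable_fun_if => //.
- by apply: measurable_fun_ltr => //; exact: measurable_cst.
- apply: measurable_funTS; apply: measurable_maxr => //; exact: measurable_funB.
- apply: measurable_funTS; apply: measurable_maxr => //; exact: measurable_funB.
Qed.

Section crossing.
Variables (P : probability (R * R)%type R) (B : set R).
Hypotheses (hP : martingale_coupling mu nu P) (mB : measurable B).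

(** The difference between hinge k y and the crossing is k - y if x < k and 0
    otherwise; by the martingale property its integral is that of hinge k x. So
    the defect in Jensen's inequality is exactly the mean crossing. *)
Lemma pot_sub_crossing k :
  pot P (fst @^-1` B) snd k - pot P (fst @^-1` B) fst k = \int[P]_(w in fst @^-1` B) crossing k w.
Proof.
have [hX hY hM] := (martingale_couplingP P).1 hP.
have iX := fst_integrable hX; have iY := snd_integrable hY.
have mB' := measurable_fst_preimage mB.
pose C := B `&` `]-oo, k[%classic.
have mC : measurable C by exact: measurableI.
have mC' := measurable_fst_preimage mC.
have hi Z (D : set (R * R)) : measurable D -> P.-integrable setT (EFin \o Z) ->
    P.-integrable D (EFin \o (fun w => hinge k (Z w))).
  by move=> mD iZ; apply: integrableS (integrable_hinge iZ k).
have li Z (D : set (R * R)) : measurable D -> P.-integrable setT (EFin \o Z) ->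
    P.-integrable D (EFin \o (fun w => k - Z w)).
  move=> mD iZ; apply: (@integrableS _ _ _ _ setT) => //.
  exact: (integrableB measurableT (finite_measure_integrable_cst P k measurableT) iZ).
have sC : fst @^-1` B `&` fst @^-1` C = (fst : R * R -> R) @^-1` C.
  by apply/setIidr => w [].
have patchC (f : R * R -> R) : \int[P]_(w in fst @^-1` B) (f \_ (fst @^-1` C)) w =
    \int[P]_(w in fst @^-1` C) f w.
  by rewrite -Rintegral_mkcondr sC.
have pi f : P.-integrable setT (EFin \o f) ->
    P.-integrable (fst @^-1` B) (EFin \o (f \_ (fst @^-1` C))).
  move=> fi; rewrite -restrict_EFin; apply/integrable_mkcond => //.
  rewrite -patch_setI; apply/(integrable_mkcond _ _).1; first exact: measurableI.
  by apply: integrableS fi => //; exact: measurableI.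
have lT Z : P.-integrable setT (EFin \o Z) -> P.-integrable setT (EFin \o (fun w => k - Z w)).
  by move=> iZ; exact: li.
have inC (w : R * R) : B w.1 -> (w \in (fst : R * R -> R) @^-1` C) = (w.1 < k).
  move=> Bw; apply/idP/idP; rewrite inE /C /= in_itv/=; first by move=> [].
  by [].
have eX : pot P (fst @^-1` B) fst k =
    \int[P]_(w in fst @^-1` B) ((fun w => k - w.2) \_ (fst @^-1` C)) w.
  transitivity (\int[P]_(w in fst @^-1` B) ((fun w => k - w.1) \_ (fst @^-1` C)) w).
    apply: eq_Rintegral => w; rewrite inE /= => Bw; rewrite /hinge patchE inC//.
    by case: ltP => wk; [apply/max_idPl|apply/max_idPr]; lra.
  have ik : P.-integrable (fst @^-1` C) (EFin \o cst k) by exact: finite_measure_integrable_cst.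
  rewrite !patchC !RintegralB//; [by rewrite hM|..].
  - by apply: integrableS iY.
  - by apply: integrableS iX.
rewrite eX /pot -RintegralB//; last 2 first.
- exact: hi.
- by apply: pi; exact: lT.
apply: eq_Rintegral => w; rewrite inE /= => Bw.
rewrite /crossing /hinge patchE inC//.
case: ltP => wk.
  by have [|] := leP (k - w.2) 0; have [|] := leP (w.2 - k) 0; lra.
by rewrite subr0.
Qed.

Lemma jensen_pot k : pot P (fst @^-1` B) fst k <= pot P (fst @^-1` B) snd k.
Proof.
rewrite -subr_ge0 pot_sub_crossing; apply: Rintegral_ge0 => w _; exact: crossing_ge0.
Qed.

Lemma pot_eq_crossing_null k :
  pot P (fst @^-1` B) fst k = pot P (fst @^-1` B) snd k <->
  P (fst @^-1` B `&` [set w | 0 < crossing k w]) = 0%E.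
Proof.
have [_ hY _] := (martingale_couplingP P).1 hP; have iY := snd_integrable hY.
have mB' := measurable_fst_preimage mB.
have mc : measurable_fun (fst @^-1` B) (EFin \o crossing k).
  by apply/measurable_EFinP; apply: measurable_funTS; exact: measurable_crossing.
have mpos : measurable [set w | 0 < crossing k w].
  by rewrite -[X in measurable X]setTI; apply: measurable_fun_ltr => //; exact: measurable_crossing.
have ci : P.-integrable (fst @^-1` B) (EFin \o crossing k).
  apply: (@le_integrable _ _ _ _ _ mB' _ (EFin \o (fun w => k - w.2))) => //.
    move=> w _ /=; rewrite lee_fin ger0_norm ?crossing_ge0// /crossing.
    have := ler_norm (k - w.2); have := ler_norm (- (k - w.2)); rewrite normrN.
    by have := normr_ge0 (k - w.2); case: ifP => _ ? ? ?; rewrite ge_max; apply/andP; split; lra.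
  apply: (@integrableS _ _ _ _ setT) => //.
  exact: (integrableB measurableT (finite_measure_integrable_cst P k measurableT) iY).
have e0 : pot P (fst @^-1` B) fst k = pot P (fst @^-1` B) snd k <->
    (\int[P]_(w in fst @^-1` B) (crossing k w)%:E = 0)%E.
  have := pot_sub_crossing k; rewrite /Rintegral => h; split => [e|e].
    apply/eqP; rewrite -fine_eq0; last exact: integrable_fin_num.
    by rewrite -h e subrr.
  by move: h; rewrite e /=; lra.
have e1 : (\int[P]_(w in fst @^-1` B) (crossing k w)%:E = 0)%E <->
    ae_eq P (fst @^-1` B) (EFin \o crossing k) (cst 0%E).
  rewrite -(ae_eq_integral_abs P mB' mc).
  suff -> : (\int[P]_(x in fst @^-1` B) `|(EFin \o crossing k) x| =
    \int[P]_(w in fst @^-1` B) (crossing k w)%:E)%E by [].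
  by apply: eq_integral => w _; rewrite /= ger0_norm// crossing_ge0.
split => [/e0/e1[N [mN N0 hN]]|h].
  apply/eqP; rewrite -measure_le0 -N0; apply: le_measure; rewrite ?inE//.
    exact: measurableI.
  move=> w [Bw /= cw]; apply: hN => /= /(_ Bw) [] cw0.
  by move: cw; rewrite cw0 ltxx.
apply/e0/e1; exists (fst @^-1` B `&` [set w | 0 < crossing k w]); split => //.
  exact: measurableI.
move=> w /= /not_implyP[Bw cw]; split => //.
by rewrite lt_neqAle crossing_ge0 andbT eq_sym; apply/eqP => c0; apply: cw; rewrite /= c0.
Qed.

End crossing.
End couplings.

(** * Borel approximation of projections *)

Section regularity.
Context {R : realType} (P : probability (R * R)%type R).
Implicit Types H : set (R * R).

(** Measurability of F is part of the definition because the sigma-algebra at hand is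
    the product one. *)
Definition inner_closed H := forall e, 0 < e -> exists F : set (R * R),
  [/\ closed F, measurable F, F `<=` H & fine (P (H `\` F)) <= e].

(** Approximation of both H and its complement, which makes the class stable under
    complement and thus a sigma-algebra. *)
Definition regular H := [/\ measurable H, inner_closed H & inner_closed (~` H)].

Let nd_small (F : (set (R * R))^nat) H e : (forall n, measurable (F n)) -> measurable H ->
  nondecreasing_seq F -> H = \bigcup_n F n -> 0 < e ->
  exists n, fine (P (H `\` F n)) <= e.
Proof.
move=> mF mH ndF HF e0.
have h : (fun n => P (H `\` F n)) @ \oo --> P (\bigcap_n (H `\` F n)).
  apply: (@nonincreasing_cvg_mu _ _ _ P (fun n => H `\` F n)).
  - by rewrite -ge0_fin_numE// fin_num_measure//; exact: measurableD.
  - by move=> n; exact: measurableD.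
  - by apply: bigcap_measurableType => n _; exact: measurableD.
  - by move=> p q pq; apply/subsetPset; apply: setDS; apply/subsetPset; exact: ndF.
rewrite [X in P X](_ : _ = set0) ?measure0 in h; last first.
  apply/seteqP; split => // w hw; have [Hw _] := hw 0%N Logic.I.
  move: Hw; rewrite HF => -[n _ Fn]; by have [] := hw n Logic.I.
have {h}/cvgr_le h : (fine (P (H `\` F n))) @[n --> \oo] --> (0 : R).
  by have := fine_cvg h; apply.
have /h [n _ hn] : 0 < e by [].
by exists n; apply: hn => /=.
Qed.

Let inner_closedU A B : regular A -> regular B -> inner_closed (A `|` B).
Proof.
move=> [mA iA _] [mB iB _] e e0; have e2 : 0 < e / 2 by lra.
have [F [cF mF FA hF]] := iA _ e2; have [G [cG mG GB hG]] := iB _ e2.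
exists (F `|` G); split; [exact: closedU|exact: measurableU|exact: setUSS|].
have m1 : measurable (A `\` F) by exact: measurableD.
have m2 : measurable (B `\` G) by exact: measurableD.
have h : fine (P ((A `|` B) `\` (F `|` G))) <= fine (P (A `\` F) + P (B `\` G)).
  apply: fine_le; rewrite ?fin_num_measure//.
  - by apply: measurableD; exact: measurableU.
  - by rewrite fin_numD !fin_num_measure.
  apply: le_trans (measureU2 P m1 m2); apply: le_measure; rewrite ?inE.
  - by apply: measurableD; exact: measurableU.
  - exact: measurableU.
  by move=> w [[Aw|Bw] /not_orP[nF nG]]; [left|right].
by move: h; rewrite fineD ?fin_num_measure//; lra.
Qed.

Let inner_closed_bigcap (H : (set (R * R))^nat) :
  (forall n, regular (H n)) -> inner_closed (\bigcap_n ~` H n).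
Proof.
move=> hH e e0.
have /choice[F hF] : forall n, exists F : set (R * R), [/\ closed F, measurable F,
    F `<=` ~` H n & fine (P ((~` H n) `\` F)) <= e / (2 ^ n.+1)%:R].
  by move=> n; have [_ _ iC] := hH n; apply: iC; apply: divr_gt0 => //; rewrite ltr0n expn_gt0.
have mD n : measurable ((~` H n) `\` F n).
  have [mH _ _] := hH n; have [_ mF _ _] := hF n.
  by apply: measurableD => //; exact: measurableC.
have mI : measurable (\bigcap_n ~` H n).
  by apply: bigcap_measurableType => n _; have [mH _ _] := hH n; exact: measurableC.
have mF : measurable (\bigcap_n F n) by apply: bigcap_measurableType => n _; have [] := hF n.
exists (\bigcap_n F n); split => //.
- by apply: closed_bigI => n _; have [] := hF n.
- by move=> w Fw n _; have [_ _ sF _] := hF n; apply: sF; exact: Fw.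
have h : (P (\bigcap_n ~` H n `\` \bigcap_n F n) <= \sum_(n <oo) P ((~` H n) `\` F n))%E.
  apply: measure_sigma_subadditive => //; first exact: measurableD.
  move=> w [Hw] /existsNP[n] /not_implyP[_ nF].
  by exists n => //; split => //; exact: Hw.
have : (P (\bigcap_n ~` H n `\` \bigcap_n F n) <= e%:E)%E.
  apply: (le_trans h); apply: le_trans (epsilon_trick0 xpredT (ltW e0)).
  apply: lee_nneseries => // n _; have [_ _ _ hn] := hF n.
  by rewrite -[X in (X <= _)%E]fineK ?fin_num_measure// lee_fin.
by rewrite -[X in (X <= _)%E]fineK ?fin_num_measure//; exact: measurableD.
Qed.

Let regular0 : regular set0.
Proof.
split => //.
  move=> e e0; exists set0; rewrite setD0 measure0 /= ltW//; split => //.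
  exact: closed0.
move=> e e0; exists setT; rewrite setDT measure0 /= ltW//; split => //.
by rewrite setC0.
Qed.

Let regularU A B : regular A -> regular B -> regular (A `|` B).
Proof.
move=> rA rB; split; [by apply: measurableU; [case: rA|case: rB]|exact: inner_closedU|].
have -> : ~` (A `|` B) = \bigcap_n ~` (if n is 0%N then A else B).
  apply/seteqP; split => [w /not_orP[nA nB] [|n] _//|w hw].
  by apply/not_orP; split; [exact: (hw 0%N Logic.I)|exact: (hw 1%N Logic.I)].
apply: (inner_closed_bigcap (H := fun n => if n is 0%N then A else B)) => n.
by case: n.
Qed.

Let inner_closed_bigcup (H : (set (R * R))^nat) :
  (forall n, regular (H n)) -> inner_closed (\bigcup_n H n).
Proof.
move=> hH e e0; have e2 : 0 < e / 2 by lra.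
have rG' n : regular (\big[setU/set0]_(i < n) H i).
  elim: n => [|n IH]; first by rewrite big_ord0; exact: regular0.
  by rewrite big_ord_recr/=; exact: regularU.
pose G n := \big[setU/set0]_(i < n.+1) H i.
have rG n : regular (G n) by exact: rG'.
have mG n : measurable (G n) by have [] := rG n.
have mH : measurable (\bigcup_n H n) by apply: bigcup_measurable => n _; have [] := hH n.
have ndG : nondecreasing_seq G by move=> p q pq; apply/subsetPset; exact: subset_bigsetU.
have HG : \bigcup_n H n = \bigcup_n G n by rewrite -bigcup_bigsetU_bigcup.
have [n hn] := nd_small mG mH ndG HG e2.
have [_ iG _] := rG n; have [F [cF mF FG hF]] := iG _ e2.
exists F; split => //; first by rewrite HG => w /FG Gw; exists n.
have sub : \bigcup_n H n `\` F `<=` (\bigcup_n H n `\` G n) `|` (G n `\` F).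
  by move=> w [Hw nF]; have [Gw|nG] := pselect (G n w); [right|left].
have m1 : measurable (\bigcup_n H n `\` G n) by exact: measurableD.
have m2 : measurable (G n `\` F) by exact: measurableD.
have m3 : measurable (\bigcup_n H n `\` F) by exact: measurableD.
have h : fine (P (\bigcup_n H n `\` F)) <= fine (P (\bigcup_n H n `\` G n) + P (G n `\` F)).
  apply: fine_le; rewrite ?fin_num_measure//.
  - by rewrite fin_numD !fin_num_measure.
  apply: le_trans (measureU2 P m1 m2); apply: le_measure; rewrite ?inE//.
  exact: measurableU.
by move: h; rewrite fineD ?fin_num_measure//; lra.
Qed.

Let regular_sigma : sigma_algebra setT regular.
Proof.
split.
- exact: regular0.
- by move=> A [mA iA iCA]; rewrite setTD; split => //; [exact: measurableC|rewrite setCK].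
- move=> F hF; split; first by apply: bigcup_measurable => n _; have [] := hF n.
    exact: inner_closed_bigcup.
  by rewrite setC_bigcup; exact: inner_closed_bigcap.
Qed.

Let regularC A : regular A -> regular (~` A).
Proof. by move=> [mA iA iCA]; split => //; [exact: measurableC|rewrite setCK]. Qed.

Let regular_preimage (f : R * R -> R) (A : set R) : continuous f -> measurable_fun setT f ->
  measurable A -> regular (f @^-1` A).
Proof.
move=> cf mf.
have mfB (B : set R) : measurable B -> measurable (f @^-1` B).
  by move=> mB; rewrite -[X in measurable X]setTI; exact: mf.
have sub : <<s (@RGenCInfty.G R) >> `<=` [set A | regular (f @^-1` A)].
  apply: smallest_sub.
    have [r0 rC rU] := regular_sigma; split => //.
    - by move=> B rB; rewrite /= setTD preimage_setC; exact: regularC.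
    - by move=> F rF; rewrite /= preimage_bigcup; exact: rU.
  move=> _ [x ->] /=; split; first exact: mfB.
    move=> e e0; exists (f @^-1` `[x, +oo[); rewrite setDv measure0 /= ltW//; split => //.
      by apply: closed_comp; [move=> w _; exact: cf|exact: rray_closed].
    exact: mfB.
  move=> e e0.
  pose F n := f @^-1` `]-oo, x - n.+1%:R^-1]%classic.
  have [||||n hn] := @nd_small F (~` (f @^-1` `[x, +oo[)) e _ _ _ _ e0.
  - by move=> n; exact: mfB.
  - by apply: measurableC; exact: mfB.
  - move=> p q pq; apply/subsetPset; apply: preimage_subset; apply: subset_itvl.
    by rewrite bnd_simp lerD2l lerN2 lef_pV2 ?posrE// ler_nat.
  - apply/seteqP; split => w; rewrite /F /= in_itv/= andbT.
      move=> /negP; rewrite -ltNge => wx.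
      exists (Num.bound ((x - f w)^-1)) => //=; rewrite in_itv/= lerBrDr addrC -lerBrDr.
      have xw : 0 < x - f w by lra.
      rewrite invf_ple ?posrE//; apply: ltW; apply: lt_trans (archi_boundP _) _.
        by rewrite invr_ge0 ltW.
      by rewrite ltr_nat.
    move=> [n _ /=]; rewrite in_itv/= => h; apply/negP; rewrite -ltNge.
    by apply: le_lt_trans h _; rewrite ltrBlDr ltrDl.
  exists (F n); split => //.
  - by apply: closed_comp; [move=> w _; exact: cf|exact: lray_closed].
  - exact: mfB.
  - move=> w; rewrite /F /= !in_itv/= andbT => h; apply/negP; rewrite -ltNge.
    by apply: le_lt_trans h _; rewrite ltrBlDr ltrDl.
move=> mA; apply: sub; have : (@ocitv R).-sigma.-measurable A := mA.
by rewrite RGenCInfty.measurableE.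
Qed.

Lemma measurable_regular H : measurable H -> regular H.
Proof.
rewrite measurable_prod_measurableType.
apply: (smallest_sub regular_sigma) => _ [A mA [B mB <-]].
rewrite -[_ `*` _]setCK; apply: regularC.
have -> : ~` (A `*` B) = ~` (fst @^-1` A) `|` ~` (snd @^-1` B).
  by rewrite -setCI.
apply: regularU; apply: regularC; apply: regular_preimage => //.
- by move=> w; exact: cvg_fst.
- by move=> w; exact: cvg_snd.
Qed.

(** The projection of a Borel set need not be Borel, but up to a P-null set H is a
    countable union of compact sets, whose projections are compact. *)
Lemma borel_projection H : measurable H -> exists B : set R,
  [/\ measurable B, B `<=` fst @` H & P (H `\` fst @^-1` B) = 0%E].
Proof.
move=> mH; have [_ iH _] := measurable_regular mH.
pose box n : set (R * R) := `[- n%:R, n%:R]%classic `*` `[- n%:R, n%:R]%classic.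
have mbox n : measurable (box n) by exact: measurableX.
have cbox n : compact (box n) by apply: compact_setX; exact: segment_compact.
have e0 n : 0 < n.+1%:R^-1 :> R by [].
have /choice[K hK] : forall n, exists K : set (R * R), [/\ compact K, measurable K,
    K `<=` H & fine (P (H `\` K)) <= n.+1%:R^-1].
  move=> n; have e2 : 0 < n.+1%:R^-1 / 2 :> R by apply: divr_gt0.
  have [F [cF mF FH hF]] := iH _ e2.
  have [||p hp] := @nd_small box setT _ mbox measurableT _ _ e2.
  - move=> p q pq; apply/subsetPset => w [h1 h2].
    have pq' : p%:R <= q%:R :> R by rewrite ler_nat.
    by move: h1 h2; rewrite /= !in_itv/= => /andP[? ?] /andP[? ?];
      split; rewrite /= in_itv/=; apply/andP; split; lra.
  - apply/esym; rewrite -subTset => w _.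
    exists (maxn (Num.bound `|w.1|) (Num.bound `|w.2|)) => //; split => /=; rewrite in_itv/=.
    + rewrite -ler_norml; apply: ltW; apply: lt_le_trans (archi_boundP _) _ => //.
      by rewrite ler_nat leq_maxl.
    + rewrite -ler_norml; apply: ltW; apply: lt_le_trans (archi_boundP _) _ => //.
      by rewrite ler_nat leq_maxr.
  exists (box p `&` F); split.
  - by apply: compact_closedI.
  - exact: measurableI.
  - by move=> w [_ /FH].
  have m1 : measurable (H `\` F) by exact: measurableD.
  have m2 : measurable (setT `\` box p) by exact: measurableD.
  have m3 : measurable (H `\` (box p `&` F)) by apply: measurableD => //; exact: measurableI.
  have h : fine (P (H `\` (box p `&` F))) <= fine (P (H `\` F) + P (setT `\` box p)).
    apply: fine_le; rewrite ?fin_num_measure//.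
    - by rewrite fin_numD !fin_num_measure.
    apply: le_trans (measureU2 P m1 m2); apply: le_measure; rewrite ?inE//.
      exact: measurableU.
    by move=> w [Hw /not_andP[nb|nF]]; [right|left].
  move: h hF hp; rewrite fineD ?fin_num_measure//.
  by move: (n.+1%:R^-1) => c ? ? ?; lra.
have mfK n : measurable (fst @` K n).
  have [cK _ _ _] := hK n; apply: compact_measurable; apply: continuous_compact => //.
  by apply: continuous_subspaceT => w; exact: cvg_fst.
have mB : measurable (\bigcup_n (fst @` K n)) by exact: bigcup_measurable.
have mB' : measurable (fst @^-1` (\bigcup_n (fst @` K n)) : set (R * R)).
  by rewrite -[X in measurable X]setTI; exact: measurable_fst.
exists (\bigcup_n (fst @` K n)); split => //.
  by move=> x [n _ [w Kw <-]]; exists w => //; have [_ _ sK _] := hK n; exact: sK.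
have mD : measurable (H `\` fst @^-1` (\bigcup_n (fst @` K n))) by exact: measurableD.
apply/eqP; rewrite -fine_eq0 ?fin_num_measure//; rewrite eq_le fine_ge0// andbT.
rewrite leNgt; apply/negP => p0.
set p := fine _ in p0.
have := archi_boundP (_ : 0 <= p^-1); rewrite invr_ge0 ltW// => /(_ erefl).
set n := Num.bound _ => pn.
have [_ mK KH hn] := hK n.
have : p <= n.+1%:R^-1.
  apply: le_trans hn; apply: fine_measure_le => //; first exact: measurableD.
  move=> w [Hw nB]; split => // Kw; apply: nB; exists n => //; exists w => //.
apply/negP; rewrite -ltNge invf_plt ?posrE//; apply: lt_trans pn _.
by rewrite ltr_nat.
Qed.

End regularity.

(** * Existence of a left-monotone coupling *)

Section curtain.
Context {R : realType}.
Variables (mu nu : probability R R).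
Hypotheses (mu_moment : finite_first_moment mu) (nu_moment : finite_first_moment nu).
Hypothesis mu_nu : convex_order mu nu.
Implicit Types P Q : probability (R * R)%type R.

Let mfst : measurable_fun [set: R * R] (fst : R * R -> R). Proof. exact: measurable_fst. Qed.
Let msnd : measurable_fun [set: R * R] (snd : R * R -> R). Proof. exact: measurable_snd. Qed.

(** The mass that starts in ]-oo, x] fills the shadow of the restriction of mu. *)
Definition shadow_coupling P := martingale_coupling mu nu P /\
  forall x k : R, pot P (fst @^-1` `]-oo, x]) snd k =
    pot nu setT id k - residual mu nu `]-oo, x]%classic k.

Lemma preimage_rectangle (A B : set R) :
  (fst : R * R -> R) @^-1` A `&` snd @^-1` B = A `*` B.
Proof. by []. Qed.

Lemma pot_fst P (A : set R) : (forall B : set R, measurable B -> P (fst @^-1` B) = mu B) ->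
  measurable A -> pot P (fst @^-1` A) fst = pot mu A id.
Proof.
move=> hX mA; apply: pot_eq_law => //; first exact: measurable_fst_preimage.
by move=> B mB; rewrite -preimage_setI preimage_id; apply: hX; exact: measurableI.
Qed.

Lemma pot_snd P : (forall B : set R, measurable B -> P (snd @^-1` B) = nu B) ->
  pot P setT snd = pot nu setT id.
Proof.
by move=> hY; apply: pot_eq_law => // B mB; rewrite !setTI preimage_id; exact: hY.
Qed.

(** The residuals for x <= y differ by a convex function, so the shadows increase
    with x and stay below nu, and they can be glued into a coupling. Potentials
    of X and Y on {X <= x} have the same asymptote, hence equal means, which is
    the martingale property. *)
Lemma shadow_coupling_exists : atomless mu -> exists P, shadow_coupling P.
Proof.
move=> mu0.
have mray (x : R) : measurable (`]-oo, x]%classic : set R) by exact: measurable_itv.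
have /choice[th hth] : forall x : R, exists th : {finite_measure set R -> \bar R},
    hinge_integrable th id /\
    forall k, pot th setT id k = pot nu setT id k - residual mu nu `]-oo, x]%classic k.
  by move=> x; apply: shadow_exists.
have th_nd x y : x <= y -> forall B, measurable B -> (th x B <= th y B)%E.
  move=> xy B mB; have [ix ex] := hth x; have [iy ey] := hth y.
  have [|r hr] := pot_cvx_sub_le ix iy; last by rewrite hr// leeDl.
  have -> : (fun k => pot (th y) setT id k - pot (th x) setT id k) =
      (fun k => residual mu nu `]-oo, x]%classic k - residual mu nu `]-oo, y]%classic k).
    by apply/funext => k; rewrite ex ey; ring.
  by apply: residual_sub_cvx => //; apply: subset_itvl; rewrite bnd_simp.
have th_nu x B : measurable B -> (th x B <= nu B)%E.
  move=> mB; have [ix ex] := hth x.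
  by have [r hr] := shadow_le_nu mu_moment nu_moment mu_nu (mray x) ix ex; rewrite hr// leeDl.
have th_mass x : fine (th x setT) = fine (mu `]-oo, x]%classic).
  by have [ix ex] := hth x; exact: (shadow_mass mu_moment nu_moment mu_nu (mray x) ix ex).
have [P [hP hY]] := coupling_of_increasing_family mu0 th_nd th_nu th_mass.
have hY' (B : set R) : measurable B -> P (snd @^-1` B) = nu B.
  by move=> mB; rewrite -hY// -preimage_rectangle preimage_setT setTI.
have hX (B : set R) : measurable B -> P (fst @^-1` B) = mu B.
  move=> mB; rewrite -[_ @^-1` _]setTI.
  apply: (@measure_eq_rays _ (law P measurableT mfst) mu) => // s.
  have e : [set: R * R] `&` fst @^-1` `]-oo, s] = `]-oo, s]%classic `*` setT.
    by rewrite setTI -preimage_rectangle preimage_setT setIT.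
  by rewrite -th_mass -hP//; exact: (congr1 (fun A => fine (P A)) e).
have hpot x : pot P (fst @^-1` `]-oo, x]) snd = pot (th x) setT id.
  apply: pot_eq_law => //; first exact: measurable_fst_preimage.
  by move=> B mB; rewrite setTI preimage_id; exact: hP.
exists P; split; last by move=> x k; rewrite hpot; have [_ ->] := hth x.
have iX := fst_integrable mu_moment hX; have iY := snd_integrable nu_moment hY'.
apply/martingale_couplingP => //; split => // B mB; apply: Rintegral_rays_eq => // x.
have mr := measurable_fst_preimage (mray x).
have [] // := @pot_asymp _ _ _ _ _ P P (fst @^-1` `]-oo, x]) (fst @^-1` `]-oo, x]) snd fst
  mr mr iY iX.
move=> e e0.
have [k0 hk] := convex_order_pot_asymp mu_moment nu_moment mu_nu e0.
exists k0 => k /hk; rewrite hpot (pot_fst hX)//; have [_ ->] := hth x.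
have := le_residual mu_moment nu_moment mu_nu k (mray x).
have := residual_le mu_moment nu_moment mu_nu k (mray x).
have := pot_setC (integrable_hinge mu_moment) k (mray x).
rewrite /obstacle !ler_norml => ? ? ? /andP[? ?].
by apply/andP; split; lra.
Qed.

(** Let q be rational. Where the residual is strictly below the obstacle it is
    affine, so nothing that starts after q lands there. At any other level there
    is equality in Jensen's inequality on {X <= q}, so nothing that starts
    before q crosses that level. If y' were strictly between y0 and y1, then for
    q between x and x' the first fact would put y' outside that open set and the
    second one would forbid the two moves from x. *)
Lemma shadow_coupling_left_monotone P : shadow_coupling P -> left_monotone P.
Proof.
move=> [mP hP]; have [hX hY hM] := (martingale_couplingP mu_moment nu_moment P).1 mP.
have iX := fst_integrable mu_moment hX; have iY := snd_integrable nu_moment hY.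
have mray (x : R) : measurable (`]-oo, x]%classic : set R) by exact: measurable_itv.
have mr x := measurable_fst_preimage (mray x).
have mc x := measurableC (mr x).
have iYh := integrable_hinge iY.
pose F (q : rat) := residual mu nu `]-oo, (ratr q : R)]%classic.
pose O (q : rat) : set R := [set k | F q k < obstacle mu nu `]-oo, (ratr q : R)]%classic k].
(* beyond q, the mass avoids the open set O q *)
have late q : pot P (~` (fst @^-1` `]-oo, (ratr q : R)])) snd = F q.
  apply/funext => k; have := pot_setC iYh k (mr (ratr q)).
  by rewrite pot_snd// hP /F; lra.
have local_null q k : O q k -> exists ab : rat * rat,
    ratr ab.1 < k < ratr ab.2 /\
    P (~` (fst @^-1` `]-oo, (ratr q : R)]) `&` snd @^-1` `[ratr ab.1, ratr ab.2]) = 0%E.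
  move=> Ok.
  have [|d d0 aff] := cvx_hull_affine _ (obstacle_lip mu_moment nu_moment (mray (ratr q))) Ok.
    exact: obstacle_minorant.
  have /rat_in_itvoo[a] : k - d < k by lra.
  have /rat_in_itvoo[b] : k < k + d by lra.
  rewrite !in_itv/= => /andP[kb bd] /andP[da ak].
  exists (a, b); split; first by rewrite /= ak kb.
  apply: (pot_affine_null msnd iYh (mc (ratr q)) da _ bd); first by rewrite /= ltW// (lt_trans ak).
  by move=> s z t ? ? ? ?; rewrite late; apply: aff.
have ae1 : {ae P, forall w, forall i : rat * (rat * rat),
    P (~` (fst @^-1` `]-oo, (ratr i.1 : R)]) `&` snd @^-1` `[ratr i.2.1, ratr i.2.2]) = 0%E ->
    ~ (ratr i.1 < w.1 /\ ratr i.2.1 <= w.2 <= ratr i.2.2)}.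
  apply: ae_forall_countable => -[q [a b]] /=.
  have [P0|nP] := pselect (P (~` (fst @^-1` `]-oo, (ratr q : R)]) `&` snd @^-1` `[ratr a, ratr b]) = 0%E);
    last exact: aeW.
  exists (~` (fst @^-1` `]-oo, (ratr q : R)]) `&` snd @^-1` `[ratr a, ratr b]); split => //.
    by apply: measurableI => //; exact: measurable_snd_preimage.
  move=> w /= /not_implyP[_ /contrapT[qw abw]]; split; rewrite /= in_itv//=.
  by apply/negP; rewrite -ltNge.
(* up to q, a level outside of O q is almost never crossed *)
(* one level outside of O q in each rational interval that contains any: countably
   many levels suffice to separate y0 and y1 *)
pose s (i : rat * (rat * rat)) : R :=
  xget 0 [set k | ratr i.2.1 < k < ratr i.2.2 /\ ~ O i.1 k].
have ae2 : {ae P, forall w, forall i : rat * (rat * rat),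
    ~ O i.1 (s i) -> w.1 <= ratr i.1 -> crossing (s i) w = 0}.
  apply: ae_forall_countable => -[q ab] /=.
  have [Os|nO] := pselect (O q (s (q, ab))); first exact: aeW.
  have e : pot P (fst @^-1` `]-oo, (ratr q : R)]) fst (s (q, ab)) =
      pot P (fst @^-1` `]-oo, (ratr q : R)]) snd (s (q, ab)).
    rewrite hP (pot_fst hX)//.
    have := residual_le mu_moment nu_moment mu_nu (s (q, ab)) (mray (ratr q)).
    move: nO; rewrite /O /= => /negP; rewrite -leNgt /F /obstacle; lra.
  have /(pot_eq_crossing_null mu_moment nu_moment mP (mray (ratr q))) P0 := e.
  exists (fst @^-1` `]-oo, (ratr q : R)] `&` [set w | 0 < crossing (s (q, ab)) w]); split => //.
    apply: measurableI => //; rewrite -[X in measurable X]setTI.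
    by apply: measurable_fun_ltr => //; exact: measurable_crossing.
  move=> w /= /not_implyP[_ /not_implyP[wq cw]]; split; rewrite /= ?in_itv//=.
  by rewrite lt_neqAle crossing_ge0 andbT eq_sym; exact/eqP.
have [N [mN N0 hN]] : {ae P, forall w, (forall i : rat * (rat * rat),
    P (~` (fst @^-1` `]-oo, (ratr i.1 : R)]) `&` snd @^-1` `[ratr i.2.1, ratr i.2.2]) = 0%E ->
    ~ (ratr i.1 < w.1 /\ ratr i.2.1 <= w.2 <= ratr i.2.2)) /\
    forall i : rat * (rat * rat), ~ O i.1 (s i) -> w.1 <= ratr i.1 -> crossing (s i) w = 0}.
  by apply: filterS2 ae1 ae2.
have good w : ~ N w -> _ := fun nN => contrapT (fun bad => nN (hN w bad)).
exists (~` N); split; first exact: measurableC.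
  rewrite [X in P X](_ : _ = ~` N); last by apply/seteqP; split => -[].
  by rewrite probability_setC// N0 sube0.
move=> x y0 y1 x' y' g0 g1 g' xx'; apply/negP; rewrite in_itv/= => /andP[y0y yy1].
have [_ c0] := good _ g0; have [_ c1] := good _ g1; have [l _] := good _ g'.
have /rat_in_itvoo[q] := xx'; rewrite in_itv/= => /andP[xq qx'].
have nO : ~ O q y'.
  move=> /local_null[[a b] /= [/andP[ay yb] P0]].
  by apply: (l (q, (a, b)) P0); rewrite /= qx' !ltW.
have /rat_in_itvoo[a] := y0y; have /rat_in_itvoo[b] := yy1.
rewrite !in_itv/= => /andP[yb by1] /andP[y0a ay].
have [/andP[as_ sb] nOs] : [set k | ratr a < k < ratr b /\ ~ O q k] (s (q, (a, b))).
  by rewrite /s /=; case: xgetP => [z _ //|/(_ y') []]; split => //; rewrite ay.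
have := c0 (q, (a, b)) nOs (ltW xq); have := c1 (q, (a, b)) nOs (ltW xq).
rewrite /crossing /=; move: (s (q, (a, b))) as_ sb => t ? ?.
case: ltP => xt.
  by have [|] := leP (y1 - t) 0; lra.
by move=> _; have [|] := leP (t - y0) 0; lra.
Qed.

End curtain.

(** * Uniqueness *)

(** Almost everywhere f is its own positive part, whose integral vanishes. *)
Lemma null_pos_of_integral0 d (T : measurableType d) (R : realType)
    (m : {measure set T -> \bar R}) (S : set T) (f : T -> R) :
  measurable S -> m.-integrable setT (EFin \o f) -> \int[m]_(w in S) f w = 0 ->
  m.-negligible (S `&` [set w | f w < 0]) -> m.-negligible (S `&` [set w | 0 < f w]).
Proof.
move=> mS fi f0 [N [mN N0 hN]].
have mf : measurable_fun setT f by apply/measurable_EFinP; exact: measurable_int fi.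
pose g w := Num.max (f w) 0.
have mg : measurable_fun setT g by apply: measurable_maxr.
have g0 w : 0 <= g w by rewrite /g le_max lexx orbT.
have mgS : measurable_fun S (EFin \o g) by apply/measurable_EFinP; exact: measurable_funTS.
have fiS : m.-integrable S (EFin \o f) by exact: integrableS fi.
have e : (\int[m]_(w in S) `|(EFin \o g) w| = 0)%E.
  have -> : (\int[m]_(w in S) `|(EFin \o g) w| = \int[m]_(w in S) (g w)%:E)%E.
    by apply: eq_integral => w _; rewrite /= ger0_norm.
  have -> : (\int[m]_(w in S) (g w)%:E = \int[m]_(w in S) (f w)%:E)%E.
    apply: ae_eq_integral => //.
      by apply/measurable_EFinP; exact: measurable_funTS.
    exists N; split => // w /= /not_implyP[Sw gw]; apply: hN; split => //=.
    rewrite ltNge; apply/negP => fw; apply: gw; congr (_%:E).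
    exact/max_idPl.
  by apply/eqP; rewrite -fine_eq0; [exact/eqP|exact: integrable_fin_num].
have /(ae_eq_integral_abs m mS mgS)[N' [mN' N'0 hN']] := e.
exists N'; split => // w [Sw /= fw]; apply: hN' => /= /(_ Sw) [] gw.
have : f w <= g w by rewrite /g le_max lexx.
by rewrite gw; lra.
Qed.

Section curtain.
Context {R : realType}.
Variables (mu nu : probability R R).
Hypotheses (mu_moment : finite_first_moment mu) (nu_moment : finite_first_moment nu).
Hypothesis mu_nu : convex_order mu nu.
Implicit Types P Q : probability (R * R)%type R.

Let mfst : measurable_fun [set: R * R] (fst : R * R -> R). Proof. exact: measurable_fst. Qed.
Let msnd : measurable_fun [set: R * R] (snd : R * R -> R). Proof. exact: measurable_snd. Qed.

Section left_monotone.
Variables (Q : probability (R * R)%type R) (Gamma : set (R * R)).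
Hypotheses (mQ : martingale_coupling mu nu Q) (mG : measurable Gamma) (QG : Q Gamma = 1%E).

Let hX : forall B : set R, measurable B -> Q (fst @^-1` B) = mu B.
Proof. by have [] := (martingale_couplingP mu_moment nu_moment Q).1 mQ. Qed.
Let hY : forall B : set R, measurable B -> Q (snd @^-1` B) = nu B.
Proof. by have [] := (martingale_couplingP mu_moment nu_moment Q).1 mQ. Qed.
Let iX := fst_integrable mu_moment hX.
Let iY := snd_integrable nu_moment hY.

Let offG : Q.-negligible (~` Gamma).
Proof.
exists (~` Gamma); split => //; first exact: measurableC.
by rewrite probability_setC// QG subee.
Qed.

Let meas_lt (f g : R * R -> R) : measurable_fun setT f -> measurable_fun setT g ->
  measurable [set w | f w < g w].
Proof. by move=> mf mg; rewrite -[X in measurable X]setTI; exact: measurable_fun_ltr. Qed.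

Let meas_le (f g : R * R -> R) : measurable_fun setT f -> measurable_fun setT g ->
  measurable [set w | f w <= g w].
Proof. by move=> mf mg; rewrite -[X in measurable X]setTI; exact: measurable_fun_ler. Qed.

(** If Y stays on one side of X when X is in B, the martingale property forces
    Y = X there. *)
Lemma one_sided_up (B : set R) : measurable B ->
  (forall w, Gamma w -> B w.1 -> w.1 <= w.2) ->
  Q.-negligible (fst @^-1` B `&` [set w | w.1 < w.2]).
Proof.
move=> mB h; have [_ _ hM] := (martingale_couplingP mu_moment nu_moment Q).1 mQ.
have mB' := measurable_fst_preimage mB.
apply: (@negligibleS _ _ _ _ (fst @^-1` B `&` [set w | 0 < w.2 - w.1])).
  by move=> w [Bw /=]; rewrite -subr_gt0.
apply: null_pos_of_integral0 => //; first exact: (integrableB measurableT iY iX).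
  rewrite RintegralB//; first by rewrite hM// subrr.
  - by apply: integrableS iY.
  - by apply: integrableS iX.
apply: negligibleS offG => w [Bw /=] lt Gw; have := h w Gw Bw; lra.
Qed.

Lemma one_sided_down (B : set R) : measurable B ->
  (forall w, Gamma w -> B w.1 -> w.2 <= w.1) ->
  Q.-negligible (fst @^-1` B `&` [set w | w.2 < w.1]).
Proof.
move=> mB h; have [_ _ hM] := (martingale_couplingP mu_moment nu_moment Q).1 mQ.
have mB' := measurable_fst_preimage mB.
apply: (@negligibleS _ _ _ _ (fst @^-1` B `&` [set w | 0 < w.1 - w.2])).
  by move=> w [Bw /=]; rewrite -subr_gt0.
apply: null_pos_of_integral0 => //; first exact: (integrableB measurableT iX iY).
  rewrite RintegralB//; first by rewrite hM// subrr.
  - by apply: integrableS iX.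
  - by apply: integrableS iY.
apply: negligibleS offG => w [Bw /=] lt Gw; have := h w Gw Bw; lra.
Qed.

(** No fibre of Gamma over ]-oo, x] has points on both sides of k. *)
Definition uncrossed (x k : R) := forall z y0 y1, z <= x -> Gamma (z, y0) -> Gamma (z, y1) ->
  ~ (y0 < k < y1).

(** A fibre over z < k that reaches above k lies entirely in [k, +oo[, hence to the
    right of z; a martingale moves almost no mass along such fibres. Likewise
    for a fibre over z >= k that reaches below k. The starting points of these
    fibres form a projection, replaced by a Borel set carrying the same mass. *)
Lemma uncrossed_pot x k : uncrossed x k ->
  pot Q (fst @^-1` `]-oo, x]) fst k = pot Q (fst @^-1` `]-oo, x]) snd k.
Proof.
move=> unc.
have mr : measurable (fst @^-1` `]-oo, x] : set (R * R)) by exact: measurable_fst_preimage.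
apply/(pot_eq_crossing_null mu_moment nu_moment mQ (measurable_itv _)).
apply/negligibleP.
  apply: measurableI => //; apply: meas_lt => //; exact: measurable_crossing.
(* moves crossing k upwards, and downwards *)
pose Hu := Gamma `&` fst @^-1` `]-oo, x] `&` [set w | w.1 < k] `&` [set w | k < w.2].
pose Hd := Gamma `&` fst @^-1` `]-oo, x] `&` [set w | k <= w.1] `&` [set w | w.2 < k].
have mHu : measurable Hu.
  by apply: measurableI; [apply: measurableI; [exact: measurableI|]|]; exact: meas_lt.
have mHd : measurable Hd.
  by apply: measurableI; [apply: measurableI; [exact: measurableI|exact: meas_le]|exact: meas_lt].
have up : Q.-negligible Hu.
  have [B [mB BH HB]] := borel_projection Q mHu.
  have mB' := measurable_fst_preimage mB.
  have nu1 : Q.-negligible (Hu `\` fst @^-1` B) by apply/negligibleP => //; exact: measurableD.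
  have up_side w : Gamma w -> B w.1 -> w.1 < k <= w.2.
    move=> Gw /BH[[z y1] [[[Gz zx] /= zk] ky] /= zw]; rewrite -zw zk/= leNgt.
    apply/negP => wk; apply: (unc z w.2 y1); rewrite ?wk//.
    by rewrite zw; case: (w) Gw.
  have nu2 := one_sided_up mB (fun w Gw Bw => ltW (lt_le_trans (andP (up_side w Gw Bw)).1 (andP (up_side w Gw Bw)).2)).
  apply: negligibleS (negligibleU nu1 nu2) => w Hw.
  have [Bw|nB] := pselect (B w.1); [right|by left].
  split => //=; move: Hw => [[_ /= wk] /= kw]; lra.
have down : Q.-negligible Hd.
  have [B [mB BH HB]] := borel_projection Q mHd.
  have mB' := measurable_fst_preimage mB.
  have nu1 : Q.-negligible (Hd `\` fst @^-1` B) by apply/negligibleP => //; exact: measurableD.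
  have down_side w : Gamma w -> B w.1 -> w.2 <= k <= w.1.
    move=> Gw /BH[[z y0] [[[Gz zx] /= zk] yk] /= zw]; rewrite -zw zk andbT leNgt.
    apply/negP => wk; apply: (unc z y0 w.2); rewrite ?wk ?andbT//.
    by rewrite zw; case: (w) Gw.
  have nu2 := one_sided_down mB (fun w Gw Bw => le_trans (andP (down_side w Gw Bw)).1 (andP (down_side w Gw Bw)).2).
  apply: negligibleS (negligibleU nu1 nu2) => w Hw.
  have [Bw|nB] := pselect (B w.1); [right|by left].
  split => //=; move: Hw => [[_ /= wk] /= kw]; lra.
apply: negligibleS (negligibleU offG (negligibleU up down)) => w [wx /= cw].
have [Gw|nG] := pselect (Gamma w); [right|by left].
move: cw; rewrite /crossing; case: (ltP w.1 k) => wk.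
  by rewrite lt_max ltxx orbF subr_gt0 => kw; left.
by rewrite lt_max ltxx orbF subr_gt0 => kw; right.
Qed.

End left_monotone.

(** The potential U of Y on {X > x} is a convex minorant of the obstacle by Jensen's
    inequality, so it is below the residual F. For the converse, at an uncrossed
    level U equals the obstacle, hence is at least F. A level k that is not
    uncrossed lies in some ]y0, y1[ where left-monotonicity forbids the mass that
    starts after x to land, so U is affine around k and F - U convex there. As
    F - U vanishes at infinity, the maximum principle applies. *)
Lemma left_monotone_shadow_coupling Q :
  martingale_coupling mu nu Q -> left_monotone Q -> shadow_coupling mu nu Q.
Proof.
move=> mQ [Gamma [mG QG' lm]]; split => // x k.
have QG : Q Gamma = 1%E.
  by rewrite -QG'; congr (Q _); apply/seteqP; split => -[].
have [hX hY hM] := (martingale_couplingP mu_moment nu_moment Q).1 mQ.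
have iX := fst_integrable mu_moment hX; have iY := snd_integrable nu_moment hY.
have iYh := integrable_hinge iY.
have mray : measurable (`]-oo, x]%classic : set R) by exact: measurable_itv.
have mr := measurable_fst_preimage mray.
have mc := measurableC mr.
set F := residual mu nu `]-oo, x]%classic.
pose U := pot Q (~` (fst @^-1` `]-oo, x])) snd.
have UE z : pot Q (fst @^-1` `]-oo, x]) snd z = pot nu setT id z - U z.
  have := pot_setC iYh z mr; rewrite (pot_snd hY) /U; lra.
have cU : cvx U by exact: pot_cvx.
have U_obs z : U z <= obstacle mu nu `]-oo, x]%classic z.
  have := jensen_pot mu_moment nu_moment mQ mray z.
  by rewrite UE (pot_fst hX)// /obstacle; lra.
have UF z : U z <= F z by apply: le_cvx_hull.
have U_low z : pot mu (~` `]-oo, x]%classic) id z <= U z.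
  have := jensen_pot mu_moment nu_moment mQ (measurableC mray) z.
  by rewrite (pot_fst hX)//; exact: measurableC.
have F_obs z : F z <= obstacle mu nu `]-oo, x]%classic z by exact: residual_le.
have cF : cvx F by exact: residual_cvx.
have lF := residual_lip mu_moment nu_moment mu_nu mray.
have lU : lip (fine (Q setT)) U by exact: pot_lip.
suff FU : F k <= U k by rewrite UE -?/F; have := UF k; lra.
apply/ler_addgt0Pr => e e0.
(* outside of a compact interval F - U is small *)
have DE z : F z - U z <= pot nu setT id z - pot mu setT id z.
  have := U_low z; have := F_obs z; rewrite /obstacle.
  have := pot_setC (integrable_hinge mu_moment) z mray; lra.
have mid : measurable_fun setT (@id R) by [].
have [a0 ha] := pot_small mid (integrable_hinge nu_moment) measurableT e0.
have [b0 hb] := convex_order_pot_asymp mu_moment nu_moment mu_nu e0.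
pose a := Num.min a0 k - 1; pose b := Num.max b0 k + 1.
have aa : a <= a0 by have : Num.min a0 k <= a0 by [rewrite ge_min lexx]; rewrite /a; lra.
have ak : a <= k by have : Num.min a0 k <= k by [rewrite ge_min lexx orbT]; rewrite /a; lra.
have bb : b0 <= b by have : b0 <= Num.max b0 k by [rewrite le_max lexx]; rewrite /b; lra.
have kb : k <= b by have : k <= Num.max b0 k by [rewrite le_max lexx orbT]; rewrite /b; lra.
have cD : continuous (fun z => F z - U z - e).
  apply: (@lip_continuous _ ((fine (nu setT) + fine (mu setT)) + fine (Q setT))) => s t st.
  have := lipB lF lU st; rewrite /F.
  by congr (_ <= _); congr (`|_|); ring.
have := @max_principle _ (fun z => F z - U z - e) a b cD (le_trans ak kb) _ _ _ k _.
rewrite ak kb => main; suff : F k - U k - e <= 0 by lra.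
apply: main => //.
- have := DE a; have := ha a aa; have := pot_ge0 mu id setT a; lra.
- have := DE b; have := hb b bb; have := ler_norm (pot nu setT id b - pot mu setT id b); lra.
move=> z /andP[az zb] Dz.
have [unc|] := pselect (uncrossed Gamma x z).
  have := uncrossed_pot mQ mG QG unc; rewrite UE (pot_fst hX)// => e1.
  by have := F_obs z; rewrite /obstacle; lra.
move=> /existsNP[z' /existsNP[y0 /existsNP[y1]]].
move=> /not_implyP[zx /not_implyP[G0 /not_implyP[G1 /contrapT/andP[y0z zy1]]]].
have null : Q (~` (fst @^-1` `]-oo, x]) `&` snd @^-1` `]y0, y1[) = 0%E.
  apply/eqP; rewrite -measure_le0.
  have -> : 0%E = Q (~` Gamma) by rewrite probability_setC// QG subee.
  apply: le_measure; rewrite ?inE.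
  - by apply: measurableI => //; exact: measurable_snd_preimage.
  - exact: measurableC.
  move=> [w1 w2] [/=]; rewrite in_itv/= => /negP; rewrite -ltNge => xw w2y Gw.
  by have := lm _ _ _ _ _ G0 G1 Gw (le_lt_trans zx xw); rewrite w2y.
have aff := pot_affine msnd iYh mc null.
pose d := Num.min (Num.min (z - y0) (y1 - z)) (Num.min (z - a) (b - z)).
have d0 : 0 < d by rewrite /d !lt_min !subr_gt0 y0z zy1 az zb.
have d1 : d <= z - y0 by rewrite /d !ge_min lexx.
have d2 : d <= y1 - z by rewrite /d !ge_min lexx !orbT.
have d3 : d <= z - a by rewrite /d !ge_min lexx !orbT.
have d4 : d <= b - z by rewrite /d !ge_min lexx !orbT.
exists d; split => //; [lra|lra|].
have := aff (z - d) z (z + d) ltac:(lra) ltac:(lra) ltac:(lra) ltac:(lra).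
have := cvx_midpoint z cF (ltW d0) => fm; rewrite -/U => um.
have : 2 * U z = U (z - d) + U (z + d) by apply: (mulfI (lt0r_neq0 d0)); lra.
lra.
Qed.

(** The potentials prescribe Q on the products of a ray and a Borel set. *)
Lemma shadow_coupling_unique P Q : shadow_coupling mu nu P -> shadow_coupling mu nu Q ->
  measure_eq Q P.
Proof.
move=> [mP hP] [mQ hQ].
have [_ hYP _] := (martingale_couplingP mu_moment nu_moment P).1 mP.
have [_ hYQ _] := (martingale_couplingP mu_moment nu_moment Q).1 mQ.
have iP := integrable_hinge (snd_integrable nu_moment hYP).
have iQ := integrable_hinge (snd_integrable nu_moment hYQ).
have rayE x (B : set R) : measurable B ->
    Q (fst @^-1` `]-oo, x] `&` snd @^-1` B) = P (fst @^-1` `]-oo, x] `&` snd @^-1` B).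
  have mr : measurable (fst @^-1` `]-oo, x] : set (R * R)) by exact: measurable_fst_preimage.
  apply: pot_inj => //.
  by apply/funext => k; rewrite hP hQ.
have rectE (A B : set R) : measurable A -> measurable B -> Q (A `*` B) = P (A `*` B).
  move=> mA mB; have mB' := measurable_snd_preimage mB.
  have -> : A `*` B = snd @^-1` B `&` fst @^-1` A by rewrite setIC.
  apply: (@measure_eq_rays _ (law Q mB' mfst) (law P mB' mfst)) => // s.
  by have := rayE s B mB; rewrite [X in Q X]setIC [X in P X]setIC; exact: (congr1 fine).
move=> S mS.
apply: (measure_unique [set A `*` B | A in measurable & B in measurable] (fun=> setT)) => //.
- exact: measurable_prod_measurableType.
- move=> _ _ [A1 mA1 [B1 mB1 <-]] [A2 mA2 [B2 mB2 <-]].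
  exists (A1 `&` A2); first exact: measurableI.
  by exists (B1 `&` B2); [exact: measurableI|rewrite setXI].
- by move=> _; exists setT => //; exists setT => //; rewrite setXTT.
- by rewrite bigcup_const//; exists 0%N.
- by move=> _ [A mA [B mB <-]]; exact: rectE.
- by move=> n; rewrite -ge0_fin_numE// fin_num_measure.
Qed.

End curtain.

Theorem theorem4p4 (R : realType) (mu nu : probability R R)
    (mu_moment : finite_first_moment mu)
    (nu_moment : finite_first_moment nu)
    (mu_nu : convex_order mu nu)
    (mu_atomless : atomless mu) :
  exists P : probability (R * R)%type R,
    [/\ martingale_coupling mu nu P, left_monotone P &
        forall Q : probability (R * R)%type R,
          martingale_coupling mu nu Q -> left_monotone Q -> measure_eq Q P].
Proof.
have [P sP] := shadow_coupling_exists mu_moment nu_moment mu_nu mu_atomless.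
exists P; split; first by case: sP.
  exact: (shadow_coupling_left_monotone mu_moment nu_moment mu_nu sP).
move=> Q mQ lQ; apply: (shadow_coupling_unique mu_moment nu_moment sP).
exact: left_monotone_shadow_coupling.
Qed.
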